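(* Let $f\in\mathcal S$ and $\phi\in\mathcal R$. Let $\{(b_n,q_n)\}_{n\in\mathbb N}\subset\mathbb R^2$ be a bounded sequence such that: (1) for all $\epsilon>0$ there exists $F\subset H$ such that $\mathbb N\setminus F$ is finite and, for all $n\in\mathbb N$, $\sum_{m\in F}e^{\psi_{b_n,q_n}([m])}<\epsilon$; (2) $\sup_{n\in\mathbb N}|\tilde p(b_n,q_n,p(b_n,q_n))|<\infty$; (3) $p(b_n,q_n)>LB(q_n)$ for all $n\in\mathbb N$. Then the sequence of measures $\{\mu_{b_n,q_n}\}_{n\in\mathbb N}$ on $\Lambda$ is tight.
   Context: Maps. Let $I=[0,1]$. A map $f:I\to I$ is a non-uniformly expanding R\'enyi interval map with countably many branches if: (i) there is a family $\{\Delta_i\}_{i\in\mathbb N}$ of subintervals of $I$ with pairwise disjoint interiors such that $\lim_i x_i=1$ for every sequence with $x_i\in\overline{\Delta_i}$; (ii) for every $i$, $f|_{\Delta_i}:\Delta_i\to f(\Delta_i)$ is a $C^2$ diffeomorphism, $(0,1)\subset f(\Delta_i)\subset[0,1]$, and $f|_{\Delta_i}$ extends to a $C^2$ diffeomorphism $f_i$ from an open set $W_i\supset\overline{\Delta_i}$ onto its image; (iii) there is a non-empty finite set $\mathcal I\subset\mathbb N$ (parabolic indices) such that for $i\in\mathcal I$, $f_i$ has a unique fixed point $x_i\in\overline{\Delta_i}$ with $|f_i'(x_i)|=1$, and $|f_i'(x)|>1$ for $x\in W_i\setminus\{x_i\}$; and there is $c>1$ with $|f_i'|>c$ on $W_i$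 for every $i\in H:=\mathbb N\setminus\mathcal I$; (iv) $\sup_i\sup_{x\in W_i}|f_i''(x)|/|f_i'(x)|^2<\infty$. For simplicity $\mathcal I=\{1,\dots,\#\mathcal I\}$. Coding. Let $T_i=f_i^{-1}$, $T_\omega=T_{\omega_1}\circ\dots\circ T_{\omega_n}$ and $\bar\Delta_\omega=T_\omega([0,1])$ for $\omega\in\mathbb N^n$. For $\omega\in\mathbb N^{\mathbb N}$ the set $\bigcap_n\bar\Delta_{\omega_1\cdots\omega_n}$ is a single point $\pi(\omega)$. Put $\Lambda=\pi(\mathbb N^{\mathbb N})$ (with the relative topology from $[0,1]$), $I_\omega=\bar\Delta_\omega\cap\Lambda$; $[\omega]$ denotes the cylinder set of a finite word $\omega$. Inducing. Let $\mathcal A_i=\mathbb N\setminus\{i\}$, $\mathcal D=\bigcup_{i\in H}I_i\cup\bigcup_{i\in\mathcal I}\bigcup_{j\in\mathcal A_i}I_{ij}$, $\rho(x)=\inf\{n\ge1:f^n(x)\in\mathcal D\}$ for $x\in\mathcal D$, and $\tilde f(x)=f^{\rho(x)}(x)$ on $\{\rho<\infty\}$. The induced map $\tilde f$ is admissible if there are $C\ge1$ and $\gamma(f)\le1$ with $C^{-1}\le|\tilde f'(x)|/(|f'(x)|n^{1+\gamma(f)})\le C$ for all $n\in\mathbb N$, $x\in\{\rho=n\}$. $\mathcal S$ is the set of such maps $f$ with admissible induced map. Induced coding. Let $\tilde E_1=\{iH:i\in\mathbb N\}\cup\{ji\mathcal A_i:i\in\mathcal I,j\in\mathcal A_i\}$,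 $\tilde E_n=\{ji^n\mathcal A_i:i\in\mathcal I,j\in\mathcal A_i\}$ for $n\ge2$, $\tilde{\mathcal A}=\bigcup_n\tilde E_n$ (formal symbols), $I_{iH}=\bigcup_{j\in H}I_{ij}$, $I_{ji^n\mathcal A_i}=\bigcup_{k\in\mathcal A_i}I_{ji^nk}$; $\rho=n$ on $I_e$ for $e\in\tilde E_n$. Let $B_{e,e'}=1$ if $I_{e'}\subset\tilde f(I_e)$ and $0$ otherwise (so $iH$ may be followed exactly by symbols whose first letter is in $H$, and $ji^n\mathcal A_i$ exactly by symbols with first letter $i$ and second letter(s) different from $i$). $\tilde\Sigma_B\subset\tilde{\mathcal A}^{\mathbb N}$ is the associated countable Markov shift with shift map $\tilde\sigma$, and $\tilde\pi:\tilde\Sigma_B\to\Lambda$ maps $\omega$ to the point with $\tilde f$-itinerary $\omega$, i.e. $\tilde\pi(\omega)=\pi(w(\omega_1)w(\omega_2)\cdots)$, where $w(iH)=i$ and $w(ji^n\mathcal A_i)=ji^{n-1}$. Regularity. On a countable Markov shift use $d(\omega,\omega')=e^{-k}$, $k$ the length of the longest common prefix ($d=0$ if $\omega=\omega'$). A function $\psi$ on the shift is acceptable if it is uniformly continuous and $\sup_e(\sup_{[e]}\psi-\inf_{[e]}\psi)<\infty$ over letters $e$; it is locally H\''older with exponent $\beta>0$ if $\sup\{|\psi(\tau)-\psi(\tau')|d(\tau,\tau')^{-\beta}\}<\infty$ over distinct $\tau,\tau'$ in a common cylinder of length $\ge1$. For continuous $\phi:\Lambda\to\mathbb R$ put $\tilde\phi(x)=\sum_{k=0}^{\rho(x)-1}\phi(f^k(x))$.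 $\mathcal R$ is the set of continuous $\phi:\Lambda\to\mathbb R$ with $\inf_\Lambda\phi>0$, $\phi\circ\pi$ acceptable on $\mathbb N^{\mathbb N}$, and $\tilde\phi\circ\tilde\pi$ locally H\''older with some exponent $\beta>0$. Pressure. $M(f)$ is the set of $f$-invariant Borel probability measures on $\Lambda$, $h$ is entropy, $\mu(\psi)=\int\psi\,d\mu$. $p(b,q)=\sup\{h(\mu)+\mu(-q\phi-b\log|f'|):\mu\in M(f),\ \mu(-q\phi-b\log|f'|)>-\infty\}$. $Fin=\{(b,q)\in\mathbb R^2:p(b,q)<\infty\}$, $\alpha_i=\phi(x_i)$, $LB(q)=\max_{i\in\mathcal I}\{-q\alpha_i\}$. $\psi_{b,q}=(-q\phi-b\log|f'|)\circ\pi$ on $\mathbb N^{\mathbb N}$ and $\psi_{b,q}([m])=\sup_{\tau\in[m]}\psi_{b,q}(\tau)$. One has $(b,q)\in Fin$ iff $\sum_{i\in\mathbb N}e^{\psi_{b,q}([i])}<\infty$. Induced pressure and measures. For $\psi$ on $\tilde\Sigma_B$, $\tilde P(\psi)=\lim_n\frac1n\log\sum_{\omega}\exp(\sup_{[\omega]}\sum_{k=0}^{n-1}\psi\circ\tilde\sigma^k)$, sum over admissible words $\omega$ of length $n$. $\tilde p(b,q,s)=\tilde P(-q\tilde\phi\circ\tilde\pi-b\log|\tilde f'\circ\tilde\pi|-s\rho\circ\tilde\pi)$. When this is finite there is a unique $\tilde\sigma$-invariant Gibbs measure for that potential, i.e. an invariant Borel probability $\nu$ with, for some $Q\ge1$,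 $Q^{-1}\le\nu([\omega])/\exp(\sum_{k<n}\psi(\tilde\sigma^k\tau)-n\tilde P(\psi))\le Q$ for all $n$, admissible $\omega$ of length $n$, $\tau\in[\omega]$ ($\psi$ the potential). For $(b,q)\in Fin$ with $p(b,q)>LB(q)$ one has $\tilde p(b,q,p(b,q))<\infty$; let $\tilde\mu'_{b,q}$ be the Gibbs measure for $s=p(b,q)$, $\tilde\mu_{b,q}=\tilde\mu'_{b,q}\circ\tilde\pi^{-1}$ (for which $\tilde\mu_{b,q}(\rho)<\infty$), and $\mu_{b,q}=\frac{1}{\tilde\mu_{b,q}(\rho)}\sum_{n=0}^\infty\sum_{k=n+1}^\infty\tilde\mu_{b,q}|_{\{\rho=k\}}\circ f^{-n}\in M(f)$. *)

(* Defs.v *)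
From HB Require Import structures.
From mathcomp Require Import all_boot all_order all_algebra.
From mathcomp Require Import all_classical all_reals all_analysis.

Set Implicit Arguments.
Unset Strict Implicit.
Unset Printing Implicit Defensive.
Import Order.TTheory GRing.Theory Num.Theory.
Import numFieldNormedType.Exports.

Local Open Scope classical_set_scope.
Local Open Scope ring_scope.

(* Conventions.
   - Branches are indexed by nat from 0; the parabolic indices are
     0, ..., d - 1 and H is the set of the i with d <= i.
   - Infinite words are functions on nat, finite words are sequences.
   - f' and the return time rho depend on the itinerary of a point of Lambda.
     A point that is a common endpoint of two branch domains can belong to two
     sets closure (Delta i), or even have two codings, so these quantities are
     functions of a coding u, standing for their value at cpi u. *)

(** * Maps *)

Definition C2_on (R : realType) (g : R -> R) (W : set R) : Prop :=
  forall x, W x ->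
    [/\ derivable g x 1, derivable (derive1 g) x 1 &
      {for x, continuous (derive1n 2 g)}].

Definition C2_diffeo (R : realType) (g : R -> R) (W : set R) : Prop :=
  [/\ open W, open (g @` W), C2_on g W &
      exists2 h : R -> R, C2_on h (g @` W) & forall x, W x -> h (g x) = x].

(* fb i is the extension f_i to Wdom i; its being a C^2 diffeomorphism makes the
   restriction of f to Delta i one, with one-sided derivatives at endpoints. *)
Record renyi_map (R : realType) := RenyiMap {
  rf :> R -> R ;
  Delta : nat -> set R ;
  Wdom : nat -> set R ;
  fb : nat -> R -> R ;
  npar : nat ;
  xpar : nat -> R ;
  rf_I : forall x, 0 <= x <= 1 -> 0 <= rf x <= 1 ;
  Delta_itv : forall i, is_interval (Delta i) ;
  Delta_I : forall i, Delta i `<=` `[0, 1] ;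
  Delta_disj : forall i j, i <> j ->
    interior (Delta i) `&` interior (Delta j) = set0 ;
  Delta_lim : forall x : nat -> R,
    (forall i, closure (Delta i) (x i)) -> x @ \oo --> (1 : R) ;
  fb_diffeo : forall i, C2_diffeo (fb i) (Wdom i) ;
  W_Delta : forall i, closure (Delta i) `<=` Wdom i ;
  fbE : forall i x, Delta i x -> rf x = fb i x ;
  rf_full : forall i, `]0, 1[ `<=` rf @` Delta i ;
  rf_full_I : forall i, rf @` Delta i `<=` `[0, 1] ;
  npar_gt0 : (0 < npar)%N ;
  xpar_fix : forall i, (i < npar)%N ->
    closure (Delta i) (xpar i) /\ fb i (xpar i) = xpar i ;
  xpar_uniq : forall i, (i < npar)%N -> forall y,
    closure (Delta i) y -> fb i y = y -> y = xpar i ;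
  xpar_neutral : forall i, (i < npar)%N -> `|derive1 (fb i) (xpar i)| = 1 ;
  par_expand : forall i, (i < npar)%N -> forall x, Wdom i x -> x <> xpar i ->
    1 < `|derive1 (fb i) x| ;
  hyp_expand : exists2 c : R, 1 < c &
    forall i, (npar <= i)%N -> forall x, Wdom i x -> c < `|derive1 (fb i) x| ;
  renyi_cond : exists M : R, forall i x, Wdom i x ->
    `|derive1n 2 (fb i) x| / `|derive1 (fb i) x| ^+ 2 <= M
}.

(** * Shift spaces *)

Section Shift.
Variables (R : realType) (A : choiceType).
Implicit Types (S : set (nat -> A)) (t u : nat -> A).

Definition wshift u : nat -> A := fun k => u k.+1.

Definition lcp t u : nat :=
  xget 0%N [set k | mkseq t k = mkseq u k /\ t k <> u k].

Definition dshift t u : R := if `[< t = u >] then 0 else expR (- (lcp t u)%:R).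

(* The words of S starting with w. *)
Definition cyl S (w : seq A) : set (nat -> A) :=
  [set u | S u /\ mkseq u (size w) = w].

Definition acceptable S (psi : (nat -> A) -> R) : Prop :=
  (forall eps : R, 0 < eps -> exists2 del : R, 0 < del &
     forall t u, S t -> S u -> dshift t u < del -> `|psi t - psi u| < eps) /\
  (ereal_sup [set (ereal_sup [set (psi t)%:E | t in cyl S [:: e]] -
                   ereal_inf [set (psi t)%:E | t in cyl S [:: e]])%E |
              e in [set: A]] < +oo)%E.

Definition locally_holder S (psi : (nat -> A) -> R) (beta : R) : Prop :=
  exists M : R, forall t u, S t -> S u -> t 0%N = u 0%N -> t <> u ->
    `|psi t - psi u| * (dshift t u) `^ (- beta) <= M.

Definition birkhoff (n : nat) (psi : (nat -> A) -> R) u : R :=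
  \sum_(k < n) psi (iter k wshift u).

End Shift.

(** * Coding of the map *)

Section Coding.
Variables (R : realType) (f : renyi_map R).

Definition parabolic (i : nat) : Prop := (i < npar f)%N.
Definition hyperbolic : set nat := [set i | (npar f <= i)%N].

Definition Tinv (i : nat) (y : R) : R := xget 0 [set x | Wdom f i x /\ fb f i x = y].

Definition Tw (w : seq nat) (y : R) : R := foldr Tinv y w.

Definition barDelta (w : seq nat) : set R := Tw w @` `[0, 1].

Definition cpi (u : nat -> nat) : R :=
  xget 0 (\bigcap_n barDelta (mkseq u n)).

Definition Lambda : set R := range cpi.

Definition itin (x : R) : nat -> nat := xget (fun=> 0%N) [set u | cpi u = x].

(* The map f on Lambda. The second case only concerns an endpoint of Delta i
   that does not belong to Delta i while its coding starts with i; there f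
   stands for the extension f_i, so that f (cpi u) = cpi (wshift u). *)
Definition fL (x : R) : R :=
  if pselect (exists2 i, Delta f i x & exists2 u, cpi u = x & u 0%N = i)
  then f x else fb f (itin x 0%N) x.

(* f_{w_n} o ... o f_{w_1}, the branch of f^n on the points coded by w. *)
Definition fword (w : seq nat) (x : R) : R := foldl (fun y i => fb f i y) x w.

(* (f^n)' at the point cpi u. *)
Definition dfn (n : nat) (u : nat -> nat) : R := derive1 (fword (mkseq u n)) (cpi u).

Definition df (x : R) : R := dfn 1 (itin x).

(** * Inducing *)

Definition Dind : set (nat -> nat) :=
  (\bigcup_(i in hyperbolic) cyl setT [:: i]) `|`
  (\bigcup_(i in parabolic) \bigcup_(j in [set j | j <> i]) cyl setT [:: i; j]).

Definition return_at (u : nat -> nat) (n : nat) : Prop :=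
  (1 <= n)%N /\ Dind (iter n (@wshift nat) u).

(* The value 0 stands for an infinite return time. *)
Definition rho (u : nat -> nat) : nat :=
  xget 0%N [set n | return_at u n /\ forall m, return_at u m -> (n <= m)%N].

Definition rho_level (n : nat) : set (nat -> nat) :=
  [set u | Dind u /\ (1 <= n)%N /\ rho u = n].

Definition dfind (u : nat -> nat) : R := dfn (rho u) u.

Definition admissible_map : Prop :=
  exists C gam : R, [/\ 1 <= C, gam <= 1 &
    forall n u, rho_level n u ->
      C^-1 <= `|dfind u| / (`|dfn 1 u| * n%:R `^ (1 + gam)) <= C].

End Coding.

(** * Induced coding *)

(* LetH i is the symbol iH and LetA j i n is the symbol j i^n A_i. *)
Inductive letter := LetH of nat | LetA of nat & nat & nat.

Definition letter_code (e : letter) : nat + nat * nat * nat :=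
  match e with LetH i => inl i | LetA j i n => inr (j, i, n) end.

Definition letter_decode (s : nat + nat * nat * nat) : letter :=
  match s with inl i => LetH i | inr (j, i, n) => LetA j i n end.

Lemma letter_codeK : cancel letter_code letter_decode.
Proof. by case. Qed.

HB.instance Definition _ := Countable.copy letter (can_type letter_codeK).
HB.instance Definition _ := isPointed.Build letter (LetH 0).

(* The cylinders form a countable base of the topology of dshift, so the
   sigma-algebra they generate is the Borel one. *)
Definition letter_cylinders : set (set (nat -> letter)) :=
  [set cyl setT w | w in [set: seq letter]].

Definition shift_space := g_sigma_algebraType letter_cylinders.

Section Induced.
Variables (R : realType) (f : renyi_map R).

Definition is_letter (e : letter) : Prop :=
  match e with
  | LetH _ => True
  | LetA j i n => [/\ parabolic f i, j <> i & (1 <= n)%N]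
  end.

Definition wletter (e : letter) : seq nat :=
  match e with LetH i => [:: i] | LetA j i n => j :: nseq n.-1 i end.

Definition fstletter (e : letter) : nat :=
  match e with LetH i => i | LetA j _ _ => j end.

Definition sndletters (e : letter) : set nat :=
  match e with LetH _ => hyperbolic f | LetA _ i _ => [set i] end.

(* B_{e,e'} = 1: the set I_{e'} is contained in f~(I_e), which is the union of
   the I_k, k in H, if e = iH and of the I_{ik}, k <> i, if e = j i^n A_i. *)
Definition follows (e e' : letter) : Prop :=
  match e with
  | LetH _ => hyperbolic f (fstletter e')
  | LetA _ i _ => fstletter e' = i /\ ~ sndletters e' i
  end.

Definition SigB : set (nat -> letter) :=
  [set om | (forall k, is_letter (om k)) /\
            (forall k, follows (om k) (om k.+1))].

Definition admissible_word (w : seq letter) : Prop :=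
  (forall k, (k < size w)%N -> is_letter (nth point w k)) /\
  (forall k, (k.+1 < size w)%N -> follows (nth point w k) (nth point w k.+1)).

(* The infinite concatenation of the (nonempty) words w(om 0), w(om 1), ... *)
Definition conc (om : nat -> letter) : nat -> nat :=
  fun k => nth 0%N (flatten (map wletter (mkseq om k.+1))) k.

Definition pit (om : nat -> letter) : R := cpi f (conc om).

(* The value at cpi u of the induced function of phi. *)
Definition phit (phi : R -> R) (u : nat -> nat) : R :=
  \sum_(k < rho f u) phi (iter k (fL f) (cpi f u)).

Definition regular (phi : R -> R) : Prop :=
  [/\ {within Lambda f, continuous phi},
      (0 < ereal_inf [set (phi x)%:E | x in Lambda f])%E,
      acceptable setT (phi \o cpi f) &
      exists2 beta : R, 0 < beta &
        locally_holder SigB (phit phi \o conc) beta].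

(** * Pressure *)

Section Entropy.
Variable mu : probability (measurableTypeR R) R.

Definition invariant_measure : Prop :=
  mu (Lambda f) = 1%E /\
  (forall A : set (measurableTypeR R), measurable A ->
     mu (Lambda f `&` fL f @^-1` A) = mu A).

Definition eta_ent (t : R) : R := - (t * ln t).

(* Shannon entropy of the join of P, f^-1 P, ..., f^-(n-1) P, where the finite
   partition P is given by its label function. *)
Definition Hjoin k (P : R -> 'I_k) (n : nat) : R :=
  \sum_(s : {ffun 'I_n -> 'I_k})
    eta_ent (fine (mu (Lambda f `&`
      [set x | forall j : 'I_n, P (iter j (fL f) x) = s j]))).

Definition measurable_partition k (P : R -> 'I_k) : Prop :=
  forall i, measurable (P @^-1` [set i] : set (measurableTypeR R)).

Definition entropy : \bar R :=
  ereal_sup [set h | exists k (P : R -> 'I_k), measurable_partition P /\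
    h = limn (fun n => ((n%:R)^-1 * Hjoin P n)%:E)].

End Entropy.

Variable phi : R -> R.

Definition free_energy_integral (b q : R)
    (mu : probability (measurableTypeR R) R) : \bar R :=
  (\int[mu]_(x in Lambda f) (- q * phi x - b * ln `|df f x|)%:E)%E.

Definition pressure (b q : R) : \bar R :=
  ereal_sup [set (entropy mu + free_energy_integral b q mu)%E | mu in
    [set mu | invariant_measure mu /\ (-oo < free_energy_integral b q mu)%E]].

Definition in_Fin (b q : R) : Prop := (pressure b q < +oo)%E.

Definition LB (q : R) : R :=
  \big[Num.max/ - q * phi (xpar f 0)]_(i < npar f) (- q * phi (xpar f i)).

Definition psi_bq (b q : R) (u : nat -> nat) : R :=
  - q * phi (cpi f u) - b * ln `|dfn f 1 u|.

Definition psi_sup (b q : R) (m : nat) : \bar R :=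
  ereal_sup [set (psi_bq b q u)%:E | u in cyl setT [:: m]].

(** * Induced pressure and measures *)

Definition Zind (psi : (nat -> letter) -> R) (n : nat) : \bar R :=
  \esum_(w in [set w | size w = n /\ admissible_word w])
    expeR (ereal_sup [set (birkhoff n psi om)%:E | om in cyl SigB w]).

Definition Pind (psi : (nat -> letter) -> R) : \bar R :=
  limn (fun n => ((n%:R)^-1)%:E * lne (Zind psi n))%E.

Definition pot (b q s : R) (om : nat -> letter) : R :=
  - q * phit phi (conc om) - b * ln `|dfind f (conc om)|
  - s * (rho f (conc om))%:R.

Definition ptilde (b q s : R) : \bar R := Pind (pot b q s).

Definition invariant_gibbs (psi : (nat -> letter) -> R)
    (nu : probability shift_space R) : Prop :=
  [/\ nu SigB = 1%E,
      forall A : set shift_space, measurable A ->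
        nu (@wshift letter @^-1` A) = nu A &
      exists2 P : R, Pind psi = P%:E &
      exists2 Q : R, 1 <= Q &
        forall (w : seq letter) (om : nat -> letter),
          admissible_word w -> cyl SigB w om ->
          Q^-1 <= fine (nu (cyl SigB w)) /
                  expR (birkhoff (size w) psi om - (size w)%:R * P) <= Q].

(* nu is the measure mu~'_{b,q}: the Gibbs measure for s = p(b,q), defined for
   (b,q) in Fin with p(b,q) > LB(q). *)
Definition is_induced_gibbs (b q : R) (nu : probability shift_space R) : Prop :=
  [/\ in_Fin b q, ((LB q)%:E < pressure b q)%E &
      invariant_gibbs (pot b q (fine (pressure b q))) nu].

(* mu~(rho), where mu~ is the image of nu by pit. *)
Definition mean_rho (nu : probability shift_space R) : \bar R :=
  (\int[nu]_(om in SigB) ((rho f (conc om))%:R)%:E)%E.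

(* The measure mu~ restricted to {rho = k} and evaluated at f^-n (A). *)
Definition mut_level (nu : probability shift_space R) (k n : nat) (A : set R) :
    \bar R :=
  nu (SigB `&` [set om | rho_level f k (conc om)] `&`
      pit @^-1` (iter n (fL f) @^-1` A)).

(* The measure mu_{b,q} when nu is mu~'_{b,q}. *)
Definition mu_of (nu : probability shift_space R) (A : set R) : \bar R :=
  (((fine (mean_rho nu))^-1)%:E *
   \sum_(0 <= n <oo) \sum_(n.+1 <= k <oo) mut_level nu k n A)%E.

(* Compactness in the relative topology of Lambda is compactness in R. *)
Definition tight_on_Lambda (mu : nat -> set R -> \bar R) : Prop :=
  forall eps : R, 0 < eps -> exists K : set R,
    [/\ compact K, K `<=` Lambda f &
        forall n, (mu n (Lambda f `\` K) < eps%:E)%E].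

End Induced.

(* Main.v *)
Require Import Defs.
From mathcomp Require Import all_boot all_order all_algebra.
From mathcomp Require Import all_classical all_reals all_analysis measurable_realfun.
From mathcomp Require Import ring lra.
Import Order.TTheory GRing.Theory Num.Theory.
Import numFieldNormedType.Exports.
Set Implicit Arguments.
Unset Strict Implicit.
Unset Printing Implicit Defensive.
Local Open Scope classical_set_scope.
Local Open Scope ring_scope.

(* Since mu_{b,q} is f-invariant and f o pi = pi o shift on all codings, it is
   enough to bound, uniformly in n, the mass of the points of Lambda whose first
   symbol exceeds N; for N beyond the parabolic indices that mass is at most the
   mass nu_n gives to the letters of the induced alphabet starting with such a
   symbol.

   The Gibbs constant Q_n of nu_n is not assumed bounded, and it disappears in
   the limit of long words. If exp(psi - P) <= A(e) on each letter e, with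
   sum_e A(e) <= K and sum_{e in E} A(e) <= d < 1, then nu[w] <= Q prod A(w_k)
   and invariance give, by Jensen's inequality for d^{-#{k : w_k in E}},
     d^{-m nu(E)} <= Q (K + 1)^m  for all m,
   hence nu(E) log(1/d) <= log(K + 1).

   To find A, fix a hyperbolic index h. Replacing the first symbol of a letter
   m i^n A_i by h changes the potential by psi_{b,q} at the two points, up to a
   constant, so A(m i^n A_i) = c exp(psi_{b,q}([m])) r(i,n), where r(i,n) is the
   weight of h i^n A_i. The sum of the r(i,n) is bounded uniformly: the words
   (h i^n A_i)(iH) can be concatenated freely, so the lower Gibbs bound gives
   (sum of their weights)^k <= Q for all k, that is, sum <= 1. This costs a
   factor exp(p(b,q)), so a large p(b,q) is treated by a geometric series. *)

(** * Branches *)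

Section Branches.
Variables (R : realType) (f : renyi_map R).
Implicit Types (i : nat) (x y : R).

Definition dl i : R := inf (Delta f i).
Definition dr i : R := sup (Delta f i).

Lemma Delta_preimage i y : 0 < y < 1 -> exists2 x, Delta f i x & fb f i x = y.
Proof.
move=> y01; have /(@rf_full _ f i) [x Dx fx] : `]0, 1[%classic y by rewrite /= in_itv.
by exists x => //; rewrite -fx (fbE Dx).
Qed.

Lemma Delta_has_bounds i : has_lbound (Delta f i) /\ has_ubound (Delta f i).
Proof.
by split; [exists 0|exists 1] => x /Delta_I; rewrite /= in_itv /= => /andP[].
Qed.

Lemma dl_dr_bound i x : Delta f i x -> dl i <= x <= dr i.
Proof.
have [lb ub] := Delta_has_bounds i.
by move=> Dx; rewrite (ge_inf lb Dx) (ub_le_sup ub Dx).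
Qed.

Lemma dl_lt_dr i : dl i < dr i.
Proof.
have [|x Dx fx] := @Delta_preimage i (1 / 3); first by apply/andP; split; lra.
have [|y Dy fy] := @Delta_preimage i (2 / 3); first by apply/andP; split; lra.
rewrite ltNge; apply/negP => le_rl.
have /andP[lx xr] := dl_dr_bound Dx; have /andP[ly yr] := dl_dr_bound Dy.
have xy : x = y by apply/eqP; rewrite eq_le; apply/andP; split; lra.
by move: fy; rewrite -xy fx; lra.
Qed.

Lemma interior_DeltaE i : interior (Delta f i) = `]dl i, dr i[%classic.
Proof.
have [lb ub] := Delta_has_bounds i.
rewrite (interval_bounded_interior (@Delta_itv _ f i) lb ub).
by apply/seteqP; split => x /=; rewrite in_itv.
Qed.

Lemma Delta_oo i x : dl i < x < dr i -> Delta f i x.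
Proof.
move=> lxr; apply: (@interior_subset _ (Delta f i)).
by rewrite interior_DeltaE /= in_itv.
Qed.

Lemma dl_ge0 i : 0 <= dl i.
Proof.
have [|x0 D0 _] := @Delta_preimage i (1 / 2); first by apply/andP; split; lra.
apply: lb_le_inf; first by exists x0.
by move=> z /Delta_I; rewrite /= in_itv /= => /andP[].
Qed.

Lemma dr_le1 i : dr i <= 1.
Proof.
have [|x0 D0 _] := @Delta_preimage i (1 / 2); first by apply/andP; split; lra.
apply: ge_sup; first by exists x0.
by move=> z /Delta_I; rewrite /= in_itv /= => /andP[].
Qed.

Lemma closure_DeltaE i : closure (Delta f i) = `[dl i, dr i]%classic.
Proof.
apply/seteqP; split.
  rewrite (_ : `[_, _]%classic = closure `[dl i, dr i]%classic); last first.
    by apply/closure_id; exact: itv_closed.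
  by apply: closure_subset => x /dl_dr_bound; rewrite /= in_itv.
move=> x; rewrite /= in_itv /= => /andP[lx xr].
move=> B /nbhs_ballP [e /= e0 eB].
have lr := dl_lt_dr i.
pose m := (dl i + dr i) / 2.
(* Moving [x] by the fraction [t] towards the midpoint [m] enters the open interval. The interval
   has length at most 1, so the displacement is at most [t], which is below [e]. *)
pose t := Num.min 1 (e / 2).
have t0 : 0 < t by rewrite lt_min; apply/andP; split; lra.
have t1 : t <= 1 by rewrite ge_min lexx.
have te : t < e by rewrite gt_min; apply/orP; right; lra.
have mE : m = (dl i + dr i) / 2 by [].
have lr1 : dr i - dl i <= 1 by have := dl_ge0 i; have := dr_le1 i; lra.
exists (x + t * (m - x)); split.
  apply: Delta_oo; apply/andP; split; rewrite mE; nra.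
apply: eB; rewrite /ball /= opprD addrA subrr sub0r normrN normrM gtr0_norm //.
have mx1 : `|m - x| <= 1 by rewrite ler_norml; apply/andP; split; rewrite mE; lra.
by apply: le_lt_trans te; rewrite ler_piMr // ltW.
Qed.

Lemma Wdom_itv i x : x \in `[dl i, dr i] -> Wdom f i x.
Proof. by move=> xi; apply: W_Delta; rewrite closure_DeltaE. Qed.

Lemma Wdom_inj i x y : Wdom f i x -> Wdom f i y -> fb f i x = fb f i y -> x = y.
Proof.
have [_ _ _ [h _ hK]] := @fb_diffeo _ f i.
by move=> Wx Wy exy; rewrite -(hK _ Wx) -(hK _ Wy) exy.
Qed.

Lemma fb_derivable i x : Wdom f i x -> derivable (fb f i) x 1.
Proof. by have [_ _ C2 _] := @fb_diffeo _ f i => /C2 []. Qed.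

Lemma fb_continuous i x : Wdom f i x -> {for x, continuous (fb f i)}.
Proof.
by move=> /fb_derivable /derivable1_diffP; exact: differentiable_continuous.
Qed.

Lemma fb_within i : {within `[dl i, dr i], continuous (fb f i)}.
Proof.
apply: continuous_in_subspaceT => x; rewrite inE => /Wdom_itv; exact: fb_continuous.
Qed.

Lemma dfb_bounded i : exists2 B : R, 1 <= B &
  forall x, x \in `[dl i, dr i] -> `|derive1 (fb f i) x| <= B.
Proof.
have [|c _ cmax] := @EVT_max R (fun x => `|derive1 (fb f i) x|) _ _ (ltW (dl_lt_dr i)).
  apply: continuous_in_subspaceT => x; rewrite inE => /Wdom_itv Wx.
  have [_ _ C2 _] := @fb_diffeo _ f i.
  have [_ d2 _] := C2 _ Wx.
  apply: continuous_comp; last exact: norm_continuous.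
  by move/derivable1_diffP: d2; exact: differentiable_continuous.
exists (Num.max 1 `|derive1 (fb f i) c|); first by rewrite le_max lexx.
by move=> x xi; rewrite le_max cmax ?orbT.
Qed.

Lemma dfb_ge1 i x : x \in `[dl i, dr i] -> 1 <= `|derive1 (fb f i) x|.
Proof.
move=> /Wdom_itv Wx; have [ip|hi] := ltnP i (npar f).
  have [->|/eqP xp] := eqVneq x (xpar f i); first by rewrite xpar_neutral.
  exact/ltW/par_expand.
have [c c1 cP] := @hyp_expand _ f.
exact/ltW/(lt_trans c1)/cP.
Qed.

Lemma fb_mono i : unstable.strict_monotonic `[dl i, dr i] (fb f i).
Proof.
apply: itv_continuous_inj_mono; first exact: fb_within.
by move=> x y /Wdom_itv Wx /Wdom_itv Wy; exact: Wdom_inj.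
Qed.

(** Points of [Delta f i] are mapped into the closed interval, and continuity of the extended branch
    carries this over to the closure. *)
Lemma fb_unit i x : x \in `[dl i, dr i] -> fb f i x \in `[0, 1].
Proof.
move=> xi; have Wx := Wdom_itv xi; apply: contrapT => /negP nfx.
have nb : nbhs (fb f i x) (~` `[0, 1]%classic).
  apply: open_nbhs_nbhs; split; first exact/closed_openC/itv_closed.
  by rewrite /= (negbTE nfx).
have : closure (Delta f i) x by rewrite closure_DeltaE.
move=> /(_ _ (fb_continuous Wx nb)) [z [Dz]] /=; apply.
by apply: (@rf_full_I _ f i); exists z => //; rewrite (fbE Dz).
Qed.

(** The branch is strictly monotone and takes every value in the open unit interval. If an endpoint
    value missed 0 or 1, a value halfway beyond it would be taken inside the domain, against
    monotonicity. *)
Lemma fb_ends i : (fb f i (dl i) = 0 /\ fb f i (dr i) = 1) \/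
  (fb f i (dl i) = 1 /\ fb f i (dr i) = 0).
Proof.
have lr := dl_lt_dr i.
have li : dl i \in `[dl i, dr i] by rewrite in_itv /= lexx ltW.
have ri : dr i \in `[dl i, dr i] by rewrite in_itv /= lexx ltW.
have := fb_unit li; have := fb_unit ri; rewrite !in_itv /=.
set p := fb f i (dl i); set q := fb f i (dr i) => /andP[q0 q1] /andP[p0 p1].
have pre y : 0 < y < 1 -> exists2 x, x \in `[dl i, dr i] & fb f i x = y.
  by move=> /Delta_preimage - /(_ i) [x /dl_dr_bound xi xy]; exists x; rewrite ?in_itv.
have bd x : x \in `[dl i, dr i] -> fb f i x = p \/ fb f i x = q \/ dl i < x < dr i.
  rewrite in_itv /= => /andP[]; rewrite le_eqVlt => /orP[/eqP <-|lx]; first by left.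
  by rewrite le_eqVlt => /orP[/eqP ->|xr]; right; [left|right; rewrite lx].
have [inc|dec] := fb_mono i.
- left; split.
    apply: contrapT => /eqP pn0.
    have pp : 0 < p by rewrite lt0r pn0.
    have [|x xi xp] := pre (p / 2); first by apply/andP; split; lra.
    have [|[|/andP[lx xr]]] := bd _ xi; rewrite ?xp; first by lra.
      have := inc _ _ li ri lr; rewrite -/p -/q; lra.
    have := inc _ _ li xi lx; rewrite -/p xp; lra.
  apply: contrapT => /eqP qn1.
  have qq : q < 1 by rewrite lt_neqAle qn1.
  have [|x xi xp] := pre ((1 + q) / 2); first by apply/andP; split; lra.
  have [|[|/andP[lx xr]]] := bd _ xi; rewrite ?xp; last 2 first.
  + by lra.
  + have := inc _ _ xi ri xr; rewrite -/q xp; lra.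
  have := inc _ _ li ri lr; rewrite -/p -/q; lra.
- right; split.
    apply: contrapT => /eqP pn1.
    have pp : p < 1 by rewrite lt_neqAle pn1.
    have [|x xi xp] := pre ((1 + p) / 2); first by apply/andP; split; lra.
    have [|[|/andP[lx xr]]] := bd _ xi; rewrite ?xp; first by lra.
      have := dec _ _ ri li lr; rewrite -/p -/q; lra.
    have := dec _ _ xi li lx; rewrite -/p xp; lra.
  apply: contrapT => /eqP qn0.
  have qq : 0 < q by rewrite lt0r qn0.
  have [|x xi xp] := pre (q / 2); first by apply/andP; split; lra.
  have [|[|/andP[lx xr]]] := bd _ xi; rewrite ?xp; last 2 first.
  + by lra.
  + have := dec _ _ ri xi xr; rewrite -/q xp; lra.
  have := dec _ _ ri li lr; rewrite -/p -/q; lra.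
Qed.

Lemma fb_surj i y : y \in `[0, 1] -> exists2 x, x \in `[dl i, dr i] & fb f i x = y.
Proof.
rewrite in_itv /= => y01.
apply: IVT; [exact/ltW/dl_lt_dr|exact: fb_within|].
have [[-> ->]|[-> ->]] := fb_ends i.
  by rewrite /Num.min /Num.max ltr01.
by rewrite /Num.min /Num.max ltr10.
Qed.

(** [Tinv] chooses a preimage anywhere in [Wdom f i]; injectivity there forces the choice to be the
    preimage in the closed branch domain. *)
Lemma TinvP i y : y \in `[0, 1] ->
  Tinv f i y \in `[dl i, dr i] /\ fb f i (Tinv f i y) = y.
Proof.
move=> /(fb_surj i) [x xi xy]; rewrite /Tinv; case: xgetP => [z _ [Wz zy]|].
  by rewrite (Wdom_inj Wz (Wdom_itv xi)) ?xi // xy.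
by move=> /(_ x) []; split=> //; exact: Wdom_itv.
Qed.

Lemma fbK i x : x \in `[dl i, dr i] -> Tinv f i (fb f i x) = x.
Proof.
move=> xi; have [Ti Te] := TinvP i (fb_unit xi).
exact: (Wdom_inj (Wdom_itv Ti) (Wdom_itv xi)).
Qed.

(** * Expansion of the branches *)

Lemma fb_MVT i x y : x \in `[dl i, dr i] -> y \in `[dl i, dr i] -> x < y ->
  exists2 z, x < z < y & `|fb f i y - fb f i x| = `|derive1 (fb f i) z| * (y - x).
Proof.
rewrite !in_itv /= => /andP[lx xr] /andP[ly yr] xy.
have sub z : z \in `[x, y] -> Wdom f i z.
  rewrite in_itv /= => /andP[xz zy]; apply: Wdom_itv; rewrite in_itv /=.
  by rewrite (le_trans lx xz) (le_trans zy yr).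
have [||z] := @MVT R (fb f i) (derive1 (fb f i)) x y xy.
- move=> z zi; have /fb_derivable dz : Wdom f i z.
    by apply: sub; move: zi; rewrite !in_itv /= => /andP[/ltW -> /ltW ->].
  by rewrite derive1E; exact: derivableP.
- apply: continuous_in_subspaceT => z; rewrite inE => /sub; exact: fb_continuous.
rewrite in_itv /= => xzy ->; exists z => //.
by rewrite normrM (gtr0_norm (_ : 0 < y - x)) // subr_gt0.
Qed.

Lemma fb_expand i x y : x \in `[dl i, dr i] -> y \in `[dl i, dr i] ->
  `|x - y| <= `|fb f i x - fb f i y|.
Proof.
wlog xy : x y / x < y.
  move=> W xi yi; case: (ltgtP x y) => [xy|yx|->]; first exact: W.
    by rewrite distrC [leRHS]distrC; exact: W.
  by rewrite !subrr.
move=> xi yi; rewrite distrC [leRHS]distrC.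
have [z /andP[xz zy] ->] := fb_MVT xi yi xy.
rewrite gtr0_norm ?subr_gt0 // ler_peMl ?subr_ge0 ?(ltW xy) // dfb_ge1 //.
move: xi yi; rewrite !in_itv /= => /andP[lx xr] /andP[ly yr].
by rewrite (le_trans lx (ltW xz)) (le_trans (ltW zy) yr).
Qed.

Lemma fb_split i x y z : x \in `[dl i, dr i] -> y \in `[dl i, dr i] ->
  x <= z <= y ->
  `|fb f i y - fb f i x| = `|fb f i y - fb f i z| + `|fb f i z - fb f i x|.
Proof.
move=> xi yi /andP[xz zy].
have zi : z \in `[dl i, dr i].
  move: xi yi; rewrite !in_itv /= => /andP[lx xr] /andP[ly yr].
  by rewrite (le_trans lx xz) (le_trans zy yr).
move: xz; rewrite le_eqVlt => /orP[/eqP <-|xz]; first by rewrite subrr normr0 addr0.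
move: zy; rewrite le_eqVlt => /orP[/eqP <-|zy]; first by rewrite subrr normr0 add0r.
have [inc|dec] := fb_mono i.
  have := inc _ _ xi zi xz; have := inc _ _ zi yi zy => a b.
  by rewrite !gtr0_norm ?subr_gt0 // ?(lt_trans b) //; lra.
have := dec _ _ zi xi xz; have := dec _ _ yi zi zy => a b.
by rewrite !ltr0_norm ?subr_lt0 // ?(lt_trans a) //; lra.
Qed.

(** The mean value theorem gives strict expansion unless the intermediate point is the neutral fixed
    point. An interval with that point in its interior is cut there. *)
Lemma fb_expand_strict i x y : (i < npar f)%N ->
  x \in `[dl i, dr i] -> y \in `[dl i, dr i] -> x < y ->
  y - x < `|fb f i y - fb f i x|.
Proof.
move=> ip xi yi xy.
have off a b : a \in `[dl i, dr i] -> b \in `[dl i, dr i] -> a < b ->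
    ~ (a < xpar f i < b) -> b - a < `|fb f i b - fb f i a|.
  move=> ai bi ab nx; have [z azb ->] := fb_MVT ai bi ab.
  rewrite ltr_pMl ?subr_gt0 //; apply: par_expand => //.
    move: ai bi azb; rewrite !in_itv /= => /andP[la ar] /andP[lb br] /andP[az zb].
    apply: Wdom_itv; rewrite in_itv /=.
    by rewrite (le_trans la (ltW az)) (le_trans (ltW zb) br).
  by move=> zx; apply: nx; rewrite -zx.
have [/andP[x1 x2]|/negP] := boolP (x < xpar f i < y); last exact: off.
have zi : xpar f i \in `[dl i, dr i].
  move: xi yi; rewrite !in_itv /= => /andP[lx xr] /andP[ly yr].
  by rewrite (le_trans lx (ltW x1)) (le_trans (ltW x2) yr).
rewrite (@fb_split i x y (xpar f i)) ?(ltW x1) ?(ltW x2) //.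
have h1 := off _ _ xi zi x1; have h2 := off _ _ zi yi x2.
rewrite ltxx andbF in h1; rewrite ltxx /= in h2.
have {}h1 : xpar f i - x < `|fb f i (xpar f i) - fb f i x| by exact: h1.
have {}h2 : y - xpar f i < `|fb f i y - fb f i (xpar f i)| by exact: h2.
lra.
Qed.

(** By compactness the excess of stretching over subintervals of length exactly [l] has a positive
    minimum; the rest of a longer interval is at least not contracted. *)
Lemma fb_gain_par i (l : R) : 0 < l -> (i < npar f)%N -> exists2 d : R, 0 < d &
  forall x y, x \in `[dl i, dr i] -> y \in `[dl i, dr i] -> l <= `|x - y| ->
    `|x - y| + d <= `|fb f i x - fb f i y|.
Proof.
move=> l0 ip; have [lr|rl] := leP (dl i) (dr i - l); last first.
  (* A domain shorter than [l] contains no such pair, so any positive [d] will do. *)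
  exists 1 => // x y; rewrite !in_itv /= => /andP[lx xr] /andP[ly yr].
  by rewrite leNgt; case/negP; rewrite ltr_norml; apply/andP; split; lra.
have shift a : a \in `[dl i, dr i - l] ->
    a \in `[dl i, dr i] /\ a + l \in `[dl i, dr i].
  by rewrite !in_itv /= => /andP[la ar]; split; apply/andP; split; lra.
have [|c ci cmin] := @EVT_min R (fun a => `|fb f i (a + l) - fb f i a|) _ _ lr.
  apply: continuous_in_subspaceT => a; rewrite inE => /shift[/Wdom_itv Wa /Wdom_itv Wal].
  apply: (@continuous_comp _ _ _ (fun a => fb f i (a + l) - fb f i a)); last first.
    exact: norm_continuous.
  apply: cvgB; last exact: fb_continuous.
  apply: (@continuous_comp _ _ _ (fun a => a + l)); last exact: fb_continuous.
  by apply: cvgD; [exact: cvg_id|exact: cvg_cst].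
have [ci1 ci2] := shift _ ci.
exists (`|fb f i (c + l) - fb f i c| - l).
  have := fb_expand_strict ip ci1 ci2; rewrite (_ : c + l - c = l); last by lra.
  by rewrite subr_gt0; apply; rewrite ltrDl.
move=> x y; wlog xy : x y / x <= y.
  move=> W xi yi; case/orP: (le_total x y) => xy; first exact: W.
  by rewrite distrC (distrC (fb f i x)); exact: W.
move=> xi yi; rewrite distrC ger0_norm ?subr_ge0 // => lxy.
have ai : x \in `[dl i, dr i - l].
  by move: xi yi; rewrite !in_itv /= => /andP[-> xr] /andP[ly yr] /=; lra.
have [_ xli] := shift _ ai.
rewrite [leRHS]distrC (@fb_split i x y (x + l)) //; last by apply/andP; split; lra.
have := cmin _ ai; have := fb_expand yi xli; rewrite ger0_norm; lra.
Qed.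

(** The gain is uniform in the branch: a minimum over the finitely many parabolic ones, and
    [(c - 1) * l] for the hyperbolic ones. *)
Lemma fb_gain (l : R) : 0 < l -> exists2 d : R, 0 < d &
  forall i x y, x \in `[dl i, dr i] -> y \in `[dl i, dr i] -> l <= `|x - y| ->
    `|x - y| + d <= `|fb f i x - fb f i y|.
Proof.
move=> l0.
have par n : (n <= npar f)%N -> exists2 d : R, 0 < d &
  forall i x y, (i < n)%N -> x \in `[dl i, dr i] -> y \in `[dl i, dr i] ->
    l <= `|x - y| -> `|x - y| + d <= `|fb f i x - fb f i y|.
  elim: n => [_|n IH nf]; first by exists 1.
  have [d d0 dP] := IH (ltnW nf); have [d' d'0 d'P] := fb_gain_par l0 nf.
  exists (Num.min d d'); first by rewrite lt_min d0.
  move=> i x y; rewrite ltnS leq_eqVlt => /orP[/eqP ->|lin] xi yi lxy.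
    apply: le_trans (d'P _ _ xi yi lxy); rewrite lerD2l ge_min lexx orbT //.
  by apply: le_trans (dP _ _ _ lin xi yi lxy); rewrite lerD2l ge_min lexx.
have [d d0 dP] := par _ (leqnn _); have [c c1 cP] := @hyp_expand _ f.
exists (Num.min d ((c - 1) * l)).
  by rewrite lt_min d0 mulr_gt0 // subr_gt0.
move=> i x y xi yi lxy; have [ip|hi] := ltnP i (npar f).
  by apply: le_trans (dP _ _ _ ip xi yi lxy); rewrite lerD2l ge_min lexx.
suff H : c * `|x - y| <= `|fb f i x - fb f i y|.
  apply: le_trans H; apply: (@le_trans _ _ (`|x - y| + (c - 1) * l)).
    by rewrite lerD2l ge_min lexx orbT.
  nra.
wlog xy : x y xi yi lxy / x < y.
  move=> W; case: (ltgtP x y) => [xy|yx|->]; first exact: W.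
    by rewrite distrC [leRHS]distrC; apply: W => //; rewrite distrC.
  by rewrite !subrr normr0 mulr0.
rewrite distrC [leRHS]distrC; have [z /andP[xz zy] ->] := fb_MVT xi yi xy.
rewrite gtr0_norm ?subr_gt0 // ler_wpM2r ?subr_ge0 ?(ltW xy) //.
apply/ltW/cP => //; apply: Wdom_itv.
move: xi yi; rewrite !in_itv /= => /andP[lx xr] /andP[ly yr].
by rewrite (le_trans lx (ltW xz)) (le_trans (ltW zy) yr).
Qed.

(** If one domain reached 1, all the others would lie to its left, below [dl i], and their right
    endpoints could not tend to 1. This keeps 1 out of the limit set. *)
Lemma dr_lt1 i : dr i < 1.
Proof.
rewrite lt_neqAle dr_le1 andbT; apply/eqP => ri.
have out j : j != i -> dr j <= dl i.
  move=> /eqP ji; rewrite leNgt; apply/negP => lirj.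
  have lj := dl_lt_dr j; have li := dl_lt_dr i; have rj := dr_le1 j.
  pose m := Num.max (dl i) (dl j).
  have mr : m < dr j by rewrite gt_max lirj lj.
  have lim : dl i <= m by rewrite le_max lexx.
  have ljm : dl j <= m by rewrite le_max lexx orbT.
  have : set0 ((m + dr j) / 2).
    rewrite -(Delta_disj f ji) !interior_DeltaE; split; rewrite /= in_itv /=;
      apply/andP; split; lra.
  by [].
have cl j : closure (Delta f j) (dr j).
  by rewrite closure_DeltaE /= in_itv /= lexx (ltW (dl_lt_dr j)).
have /cvgrPdist_lt := @Delta_lim _ f dr cl.
have e0 : 0 < 1 - dl i by rewrite subr_gt0 -ri dl_lt_dr.
move=> /(_ _ e0) [N _ NP].
have /= := NP (maxn N i.+1) (leq_maxl _ _).
have : dr (maxn N i.+1) <= dl i.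
  by apply: out; rewrite gtn_eqF // leq_maxr.
by rewrite ltr_norml => h /andP[_]; lra.
Qed.

End Branches.

(** * Coding of the limit set *)

Section CodingMap.
Variables (R : realType) (f : renyi_map R).
Implicit Types (i : nat) (x y : R) (w : seq nat) (u : nat -> nat).

Lemma Tw_unit w y : y \in `[0, 1] -> Tw f w y \in `[0, 1].
Proof.
elim: w => //= i w IH /IH y01; have [+ _] := TinvP f i y01.
rewrite !in_itv /= => /andP[l r].
by rewrite (le_trans (dl_ge0 f i) l) (le_trans r (dr_le1 f i)).
Qed.

Lemma barDelta0 x : barDelta f [::] x <-> x \in `[0, 1].
Proof. by split=> [[y]|x01]; [move=> /= + <-|exists x]. Qed.

Lemma barDelta_cons i w x :
  barDelta f (i :: w) x <-> x \in `[dl f i, dr f i] /\ barDelta f w (fb f i x).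
Proof.
split=> [[y y01 <-]|[xi [y y01 yx]]] /=.
  have [] := TinvP f i (@Tw_unit w _ y01) => Ti ->.
  by split=> //; exists y.
by exists y => //; rewrite -[RHS](fbK xi) -yx.
Qed.

Lemma barDelta_catl w v : barDelta f (w ++ v) `<=` barDelta f w.
Proof.
elim: w => [|i w IH] x; first by move=> [y /(@Tw_unit v) h <-]; apply/barDelta0.
by move=> /barDelta_cons[xi /IH ?]; apply/barDelta_cons.
Qed.

Lemma barDelta_prefix u m n : (m <= n)%N ->
  barDelta f (mkseq u n) `<=` barDelta f (mkseq u m).
Proof.
move=> mn; rewrite -(subnKC mn) /mkseq iotaD map_cat; exact: barDelta_catl.
Qed.

Lemma barDelta_closed w : closed (barDelta f w).
Proof.
elim: w => [|i w IH].
  rewrite (_ : barDelta f [::] = `[0, 1]%classic); first exact: itv_closed.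
  by apply/seteqP; split => x /barDelta0.
move=> x clx; apply/barDelta_cons.
have xi : x \in `[dl f i, dr f i].
  have : closure `[dl f i, dr f i]%classic x.
    by apply: closure_subset clx => y /barDelta_cons [].
  by rewrite -(proj1 (closure_id _)) //; exact: itv_closed.
split=> //; apply: contrapT => nb.
have nbx : nbhs (fb f i x) (~` barDelta f w).
  by apply: open_nbhs_nbhs; split=> //; exact: closed_openC.
have [y [/barDelta_cons[_ yw]]] := clx _ (fb_continuous (Wdom_itv xi) nbx).
exact.
Qed.

(** While two points are at least [l] apart, each branch applied adds at least [d] to their
    distance, which stays at most 1. Hence a word that codes two such points has length at most
    [1 / d]. *)
Lemma barDelta_diam (l : R) : 0 < l -> exists m, forall w, (m <= size w)%N ->
  forall x y, barDelta f w x -> barDelta f w y -> `|x - y| < l.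
Proof.
move=> l0; have [d d0 dP] := fb_gain f l0.
have key w x y : barDelta f w x -> barDelta f w y -> l <= `|x - y| ->
    `|x - y| + (size w)%:R * d <= 1.
  elim: w x y => [|i w IH] x y.
    move=> /barDelta0; rewrite in_itv /= => /andP[x0 x1].
    move=> /barDelta0; rewrite in_itv /= => /andP[y0 y1] _.
    by rewrite mul0r addr0 ler_norml; apply/andP; split; lra.
  move=> /barDelta_cons[xi xw] /barDelta_cons[yi yw] lxy.
  have := dP _ _ _ xi yi lxy; have := IH _ _ xw yw.
  rewrite -natr1 mulrDl mul1r => h1 h2; have := h1 (le_trans lxy _).
  rewrite (fb_expand xi yi) => /(_ isT); lra.
have [m mP] : exists m : nat, 1 / d < m%:R.
  by exists (Num.truncn (1 / d)).+1; rewrite truncnS_gt.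
exists m => w mw x y xw yw; rewrite ltNge; apply/negP => /(key _ _ _ xw yw).
have : 1 < (size w)%:R * d.
  by rewrite -ltr_pdivrMr //; apply: lt_le_trans mP _; rewrite ler_nat.
have := normr_ge0 (x - y); lra.
Qed.

(** A cluster point of the points [xs n] in the compact unit interval lies in all of the nested
    closed sets. *)
Lemma barDelta_bigcap u : (\bigcap_n barDelta f (mkseq u n)) !=set0.
Proof.
pose xs n := Tw f (mkseq u n) 0.
have xsP n : barDelta f (mkseq u n) (xs n).
  by exists 0 => //=; rewrite in_itv /= lexx ler01.
have xsP' m n : (m <= n)%N -> barDelta f (mkseq u m) (xs n).
  by move=> mn; exact: barDelta_prefix (xsP n).
have [|p [_ clp]] := @segment_compact R 0 1 (xs @ \oo) _.
  by exists 0 => // n _ /=; apply/barDelta0; exact: (xsP' 0).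
exists p => n _; apply: barDelta_closed => B nB.
have : (xs @ \oo) (barDelta f (mkseq u n)) by exists n => // k /= nk; exact: xsP'.
by move=> /clp /(_ nB).
Qed.

Lemma cpi_barDelta u n : barDelta f (mkseq u n) (cpi f u).
Proof.
rewrite /cpi; case: xgetP => [x _ /(_ n)|]; first exact.
by have [x xP /(_ x)] := barDelta_bigcap u.
Qed.

Lemma cpi_unif (e : R) : 0 < e -> exists m, forall u v,
  mkseq u m = mkseq v m -> `|cpi f u - cpi f v| < e.
Proof.
move=> /barDelta_diam[m mP]; exists m => u v uv.
apply: (mP (mkseq u m)); rewrite ?size_mkseq //; first exact: cpi_barDelta.
by rewrite uv; exact: cpi_barDelta.
Qed.

Lemma cpi_unique u x : (forall n, barDelta f (mkseq u n) x) -> cpi f u = x.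
Proof.
move=> xP; apply/eqP; rewrite -subr_eq0 -normr_le0 leNgt; apply/negP.
move=> /barDelta_diam[m mP].
have := mP (mkseq u m) _ _ _ (cpi_barDelta u m) (xP m).
by rewrite size_mkseq ltxx => /(_ (leqnn _)).
Qed.

Lemma mkseqSl (A : choiceType) (u : nat -> A) n :
  mkseq u n.+1 = u 0%N :: mkseq (wshift u) n.
Proof.
apply: (@eq_from_nth _ (u 0%N)); rewrite /= ?size_map ?size_iota // => k kn.
case: k kn => [//|k]; rewrite ltnS => kn /=.
by rewrite (nth_map 0%N) ?size_iota // nth_mkseq // nth_iota.
Qed.

Lemma cpi_itv u : cpi f u \in `[dl f (u 0%N), dr f (u 0%N)].
Proof. by have := cpi_barDelta u 1; rewrite mkseqSl => /barDelta_cons[]. Qed.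

Lemma cpi_wshift u : cpi f (wshift u) = fb f (u 0%N) (cpi f u).
Proof.
apply: cpi_unique => n.
by have := cpi_barDelta u n.+1; rewrite mkseqSl => /barDelta_cons[].
Qed.

Lemma cpi_lt1 u : cpi f u < 1.
Proof.
have := cpi_itv u; rewrite in_itv /= => /andP[_].
by move/le_lt_trans; apply; exact: dr_lt1.
Qed.

(* A point with two codings is an endpoint of two branch domains, so both
   branches map it to 0 or 1; as 1 is not in Lambda, both images are 0. *)
Lemma cpi_wshift_eq u v : cpi f u = cpi f v ->
  cpi f (wshift u) = cpi f (wshift v).
Proof.
move=> uv; have [u0|/eqP u0] := eqVneq (u 0%N) (v 0%N).
  by rewrite !cpi_wshift u0 uv.
have lu := dl_lt_dr f (u 0%N); have lv := dl_lt_dr f (v 0%N).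
have ou := @interior_DeltaE _ f (u 0%N); have ov := @interior_DeltaE _ f (v 0%N).
have disj := @Delta_disj _ f _ _ u0; rewrite ou ov in disj.
have sep : dr f (u 0%N) <= dl f (v 0%N) \/ dr f (v 0%N) <= dl f (u 0%N).
  apply: contrapT => /not_orP[/negP + /negP].
  rewrite -!ltNge => h1 h2.
  pose m := Num.max (dl f (u 0%N)) (dl f (v 0%N)).
  pose M := Num.min (dr f (u 0%N)) (dr f (v 0%N)).
  have mM : m < M by rewrite gt_max !lt_min lu lv h1 h2.
  have m1 : dl f (u 0%N) <= m by rewrite le_max lexx.
  have m2 : dl f (v 0%N) <= m by rewrite le_max lexx orbT.
  have M1 : M <= dr f (u 0%N) by rewrite ge_min lexx.
  have M2 : M <= dr f (v 0%N) by rewrite ge_min lexx orbT.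
  have : set0 ((m + M) / 2).
    by rewrite -disj; split; rewrite /= in_itv /=; apply/andP; split; lra.
  by [].
have end0 (z : nat -> nat) : cpi f z = dl f (z 0%N) \/ cpi f z = dr f (z 0%N) ->
    cpi f (wshift z) = 0.
  move=> ends; have := cpi_lt1 (wshift z); rewrite cpi_wshift.
  by have [[e1 e2]|[e1 e2]] := fb_ends f (z 0%N); case: ends => ->;
    rewrite ?e1 ?e2 // ltxx.
have := cpi_itv u; have := cpi_itv v; rewrite -uv !in_itv /=.
move=> /andP[l1 r1] /andP[l2 r2].
case: sep => sep.
- rewrite (end0 u) ?(end0 v) // -?uv; [left|right]; apply/eqP;
    rewrite eq_le; apply/andP; split; lra.
- rewrite (end0 u) ?(end0 v) // -?uv; [right|left]; apply/eqP;
    rewrite eq_le; apply/andP; split; lra.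
Qed.

(** Either case of [fL] applies the branch of some coding of the point, and by [cpi_wshift_eq] it is
    immaterial which coding that is. *)
Lemma fL_cpi u : fL f (cpi f u) = cpi f (wshift u).
Proof.
rewrite /fL; case: pselect => [[i Di [v vu v0]]|nP] /=.
  by rewrite (fbE Di) -v0 -(cpi_wshift_eq vu) cpi_wshift vu.
have iu : cpi f (itin f (cpi f u)) = cpi f u.
  by rewrite /itin; case: xgetP => [v _ /= vu|nu]; [exact: vu|case: (nu u)].
by rewrite -(cpi_wshift_eq iu) cpi_wshift iu.
Qed.

Lemma iter_fL_cpi n u : iter n (fL f) (cpi f u) = cpi f (iter n (@wshift nat) u).
Proof. by elim: n => //= n ->; rewrite fL_cpi. Qed.

Lemma iter_wshiftE (A : choiceType) (u : nat -> A) n k : iter n (@wshift A) u k = u (n + k)%N.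
Proof. by elim: n k => //= n IH k; rewrite /wshift IH addnS. Qed.

(** The bounded words form a product of finite sets, compact by Tychonoff, and [cpi f] is continuous
    for the product topology by [cpi_unif]. *)
Lemma compact_cpi_bounded (N : nat -> nat) :
  compact (cpi f @` [set u | forall k, (u k <= N k)%N]).
Proof.
have cK : compact ([set u : prod_topology (fun _ : nat => nat) | forall k, [set m | (m <= N k)%N] (u k)]).
  apply: (@tychonoff _ (fun _ : nat => nat) (fun k => [set m | (m <= N k)%N])) => k.
  apply: finite_compact; apply: (sub_finite_set _ (finite_II (N k).+1)) => m /=.
  by rewrite ltnS.
apply: (@continuous_compact (prod_topology (fun _ : nat => nat)) R (cpi f)) cK.
apply: continuous_subspaceT => u.
apply/cvgrPdist_lt => e e0; have [m mP] := cpi_unif e0.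
have : nbhs (u : prod_topology (fun _ : nat => nat)) [set v | forall k, (k < m)%N -> v k = u k].
  elim: m {mP} => [|m IH]; first by apply: filterS filterT.
  have um : nbhs (u : prod_topology (fun _ : nat => nat)) [set v | v m = u m].
    by apply: (@proj_continuous _ (fun _ : nat => nat) m u [set u m]).
  apply: filterS2 IH um => v vP vm k.
  by rewrite ltnS leq_eqVlt => /orP[/eqP ->|/vP].
by apply: filterS => v vP; apply: mP; apply/eq_in_map => k; rewrite mem_iota => /vP.
Qed.

End CodingMap.

(** * Induced coding *)

Section InducedCoding.
Variables (R : realType) (f : renyi_map R).
Implicit Types (om : nat -> letter) (e : letter) (w : seq letter).

Lemma wletter_size_gt0 e : (0 < size (wletter e))%N.
Proof. by case: e. Qed.

Lemma size_flatten_wletter w : (size w <= size (flatten (map wletter w)))%N.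
Proof.
elim: w => //= e w IH; rewrite size_cat -add1n leq_add // wletter_size_gt0 //.
Qed.

Lemma mkseq_cat (A : Type) (u : nat -> A) m n :
  mkseq u (m + n) = mkseq u m ++ mkseq (fun k => u (m + k)%N) n.
Proof.
rewrite /mkseq iotaD map_cat add0n; congr (_ ++ _).
by rewrite -[m in LHS]addn0 iotaDl -map_comp.
Qed.

Lemma conc_nth om n k : (k < size (flatten (map wletter (mkseq om n))))%N ->
  conc om k = nth 0%N (flatten (map wletter (mkseq om n))) k.
Proof.
rewrite /conc => kn.
have kS : (k < size (flatten (map wletter (mkseq om k.+1))))%N.
  by apply: leq_trans (size_flatten_wletter _); rewrite size_mkseq.
have ext a b : (a <= b)%N -> (k < size (flatten (map wletter (mkseq om a))))%N ->
    nth 0%N (flatten (map wletter (mkseq om a))) k =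
    nth 0%N (flatten (map wletter (mkseq om b))) k.
  by move=> ab ka; rewrite -(subnKC ab) mkseq_cat map_cat flatten_cat nth_cat ka.
by case/orP: (leq_total k.+1 n) => h; [|symmetry]; apply: ext.
Qed.

Lemma conc_wshift om k : conc om k =
  if (k < size (wletter (om 0%N)))%N then nth 0%N (wletter (om 0%N)) k
  else conc (@wshift letter om) (k - size (wletter (om 0%N))).
Proof.
rewrite /conc mkseqSl /= nth_cat; case: ltnP => // kl.
rewrite -/(conc (@wshift letter om) _); symmetry; apply: conc_nth.
apply: leq_trans (size_flatten_wletter _).
by rewrite size_mkseq ltn_subrL wletter_size_gt0 (leq_trans _ kl) ?wletter_size_gt0.
Qed.

Lemma wshift_conc om :
  iter (size (wletter (om 0%N))) (@wshift nat) (conc om) = conc (@wshift letter om).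
Proof.
apply/funext => k; rewrite iter_wshiftE conc_wshift ltnNge leq_addr /=.
by rewrite addKn.
Qed.

Lemma conc_lt om k : (k < size (wletter (om 0%N)))%N ->
  conc om k = nth 0%N (wletter (om 0%N)) k.
Proof. by rewrite conc_wshift => ->. Qed.

Lemma conc_size om :
  conc om (size (wletter (om 0%N))) = fstletter (om 1%N).
Proof.
rewrite conc_wshift ltnn subnn conc_lt ?wletter_size_gt0 //.
by rewrite /wshift; case: (om 1%N).
Qed.

Lemma conc0 om : conc om 0%N = fstletter (om 0%N).
Proof. by rewrite conc_lt ?wletter_size_gt0 //; case: (om 0%N). Qed.

Lemma conc_prefix om om' n : mkseq om n = mkseq om' n ->
  forall k, (k < n)%N -> conc om k = conc om' k.
Proof.
move=> E k kn; rewrite (@conc_nth om n) ?(@conc_nth om' n) ?E //;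
  by apply: leq_trans (size_flatten_wletter _); rewrite size_mkseq.
Qed.

Lemma SigB_wshift om : SigB f om -> SigB f (@wshift letter om).
Proof. by move=> [h1 h2]; split=> k; [exact: h1|exact: h2]. Qed.

(** This is membership in the inducing domain, read off from the first two symbols. For [LetA j i 1]
    the second symbol comes from the next letter. *)
Lemma SigB_conc1 om : SigB f om ->
  hyperbolic f (conc om 0%N) \/ conc om 1%N <> conc om 0%N.
Proof.
move=> [isl fol]; have := isl 0%N; have := fol 0%N.
rewrite conc0; case E : (om 0%N) => [i|j i n] /=.
  rewrite (_ : conc om 1 = fstletter (om 1%N)); last by rewrite -conc_size E.
  have [ip|] := ltnP i (npar f); last by left.
  move=> h1 _; right => e; move: h1; rewrite e /hyperbolic /= leqNgt.
  by move/negP; apply.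
move=> [h1 _] [ip ji n0]; right.
suff -> : conc om 1%N = i by apply/nesym.
case: n E n0 => [//|[|n]] E _.
  by rewrite -h1 -conc_size E.
by rewrite conc_lt E.
Qed.

Lemma SigB_Dind om : SigB f om -> Dind f (conc om).
Proof.
move=> /SigB_conc1 h; have [ip|hi] := ltnP (conc om 0%N) (npar f); last first.
  by left; exists (conc om 0%N).
case: h => [|h]; first by rewrite /hyperbolic /= leqNgt ip.
by right; exists (conc om 0%N) => //; exists (conc om 1%N).
Qed.

Lemma not_Dind_par (u : nat -> nat) i : (i < npar f)%N -> u 0%N = i -> u 1%N = i ->
  ~ Dind f u.
Proof.
move=> ip u0 u1 [[j hj [_ [uj]]]|[j _ [k /= kj [_ [uj uk]]]]].
  by move: hj; rewrite /hyperbolic /= -uj u0 leqNgt ip.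
by apply: kj; rewrite -uj -uk u0 u1.
Qed.

(** At a time strictly inside the word of [j i^n A_i] the next two symbols are both the parabolic
    [i], so the orbit is outside the inducing domain. After the whole word it is coded by the
    shifted element of [SigB]. *)
Lemma rho_conc om : SigB f om -> rho f (conc om) = size (wletter (om 0%N)).
Proof.
move=> S; set N := size _.
have N0 : (0 < N)%N by exact: wletter_size_gt0.
have rN : return_at f (conc om) N.
  by split=> //; rewrite wshift_conc; apply: SigB_Dind; exact: SigB_wshift.
have rmin m : return_at f (conc om) m -> (N <= m)%N.
  move=> [m0 Dm]; rewrite leqNgt; apply/negP => mN.
  have [isl fol] := S; move: (isl 0%N) (fol 0%N) mN; rewrite /N.
  case E : (om 0%N) => [i|j i n] /=; first by rewrite ltnS leqn0; case: m m0 {Dm}.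
  move=> [ip ji n0] [f1 _]; rewrite size_nseq prednK // => mn.
  apply: (@not_Dind_par (iter m (@wshift nat) (conc om)) i) => //.
    rewrite iter_wshiftE addn0 conc_lt E /= ?size_nseq ?prednK //.
    by case: m m0 mn {Dm} => // m _ mn /=; rewrite nth_nseq -ltnS prednK // mn.
  rewrite iter_wshiftE addn1.
  case: (ltnP m.+1 n) => mn1.
    rewrite conc_lt E /= ?size_nseq ?prednK //.
    by rewrite nth_nseq -ltnS prednK // mn1.
  (* At the last inside time the second [i] is already the first symbol of the next letter. *)
  have mE : m.+1 = n by apply/eqP; rewrite eqn_leq mn.
  have <- : size (wletter (om 0%N)) = m.+1 by rewrite E /= size_nseq prednK.
  by rewrite conc_size.
rewrite /rho; case: xgetP => [n _ [rn nmin]|/(_ N)].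
  by apply/eqP; rewrite eqn_leq nmin // rmin.
by case; split.
Qed.

Lemma rho_level_conc om : SigB f om -> rho_level f (size (wletter (om 0%N))) (conc om).
Proof.
by move=> S; split; [exact: SigB_Dind|rewrite rho_conc // wletter_size_gt0].
Qed.

Lemma rho_level_concE om k : SigB f om ->
  rho_level f k (conc om) <-> size (wletter (om 0%N)) = k.
Proof.
move=> S; split=> [[_ [_]]|<-]; last exact: rho_level_conc.
by rewrite rho_conc.
Qed.

Lemma phitE (phi : R -> R) om : SigB f om -> phit f phi (conc om) =
  \sum_(k < size (wletter (om 0%N))) phi (cpi f (iter k (@wshift nat) (conc om))).
Proof.
by move=> S; rewrite /phit rho_conc //; apply: eq_bigr => k _; rewrite iter_fL_cpi.
Qed.

End InducedCoding.

(** * Measures on the induced shift *)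

Section PrefixSets.
Implicit Types (om : shift_space) (w : seq letter).

Lemma measurable_cylT w : measurable (cyl setT w : set shift_space).
Proof. by apply: sub_sigma_algebra; exists w. Qed.

(** The alphabet is countable, so whatever [P] is the set is a countable union of cylinders. *)
Lemma measurable_prefix (P : seq letter -> Prop) n :
  measurable [set om : shift_space | P (mkseq om n)].
Proof.
pose F k : set shift_space := if unpickle k is Some w
  then (if `[< size w = n /\ P w >] then cyl setT w else set0) else set0.
rewrite (_ : [set _ | _] = \bigcup_k F k); last first.
  apply/seteqP; split=> [om Pom|om [k _]].
    exists (pickle (mkseq om n)) => //.
    rewrite /F pickleK asboolT; last by rewrite size_mkseq.
    by split=> //; rewrite size_mkseq.
  rewrite /F; case: unpickle => [w|[]]; case: asboolP => [[sw Pw]|_ []].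
  by move=> [_]; rewrite sw /= => ->.
apply: bigcupT_measurable => k; rewrite /F; case: unpickle => [w|]; last exact: measurable0.
by case: ifP => _; [exact: measurable_cylT|exact: measurable0].
Qed.

Lemma measurable_fun_prefix d (T : measurableType d) (g : seq letter -> T) n :
  measurable_fun setT (fun om : shift_space => g (mkseq om n)).
Proof.
by move=> _ Y mY; rewrite setTI; exact: (@measurable_prefix (fun w => Y (g w)) n).
Qed.

Variables (R : realType) (f : renyi_map R).

Lemma measurable_SigB : measurable (SigB f : set shift_space).
Proof.
pose P k w := is_letter f (nth point w k) /\
  follows f (nth point w k) (nth point w k.+1).
rewrite (_ : SigB f = \bigcap_k [set om : shift_space | P k (mkseq om k.+2)]).
  apply: bigcapT_measurable => k; exact: (@measurable_prefix (P k)).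
apply/seteqP; split=> [om [h1 h2] k _|om h].
  by rewrite /= /P !nth_mkseq.
by split=> k; have /= := h k Logic.I; rewrite /P !nth_mkseq // => -[].
Qed.

Lemma measurable_cyl_SigB w : measurable (cyl (SigB f) w : set shift_space).
Proof.
rewrite (_ : cyl _ _ = SigB f `&` cyl setT w).
  by apply: measurableI; [exact: measurable_SigB|exact: measurable_cylT].
by apply/seteqP; split=> om [] //= ? [] //.
Qed.

Lemma measurable_conc (N : nat) k :
  measurable [set om : shift_space | (N < conc om k)%N].
Proof.
exact: (@measurable_prefix
  (fun w => (N < nth 0%N (flatten (map wletter w)) k)%N) k.+1).
Qed.

Lemma measurable_letter0 (P : letter -> Prop) :
  measurable [set om : shift_space | P (om 0%N)].
Proof. exact: (@measurable_prefix (fun w => P (head point w)) 1). Qed.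

(** The complement of [K] is open and the coding is uniformly continuous, so avoiding [K] is already
    decided by a finite prefix. *)
Lemma measurable_cpi_notin (K : set R) n : closed K ->
  measurable ((SigB f `&`
    [set om | ~ K (cpi f (iter n (@wshift nat) (conc om)))]) : set shift_space).
Proof.
move=> cK; pose P m w := forall om, SigB f om -> mkseq om m = w ->
  ~ K (cpi f (iter n (@wshift nat) (conc om))).
rewrite (_ : _ `&` _ = SigB f `&` \bigcup_m [set om | P m (mkseq om m)]); last first.
  apply/seteqP; split=> om [S /=]; last first.
    by move=> [m _ /(_ _ S erefl)].
  move=> nK; split=> //.
  have : nbhs (cpi f (iter n (@wshift nat) (conc om))) (~` K).
    by apply: open_nbhs_nbhs; split=> //; exact: closed_openC.
  move=> /nbhs_ballP [e /= e0 eK]; have [m mP] := @cpi_unif _ f _ e0.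
  exists (n + m)%N => // om' S' omE; apply: eK; apply: mP.
  apply/eq_in_map => k; rewrite mem_iota => /andP[_ km].
  rewrite !iter_wshiftE; apply: (@conc_prefix _ _ (n + m)) => //.
  by rewrite ltn_add2l.
apply: measurableI; first exact: measurable_SigB.
by apply: bigcupT_measurable => m; exact: (@measurable_prefix (P m)).
Qed.

End PrefixSets.

(** * The tower over the induced system and the measure built from it *)

Section Tower.
Variables (R : realType) (f : renyi_map R) (nu : probability shift_space R).
Hypothesis nuS : nu (SigB f) = 1%E.
Hypothesis nu_inv : forall A : set shift_space, measurable A ->
  nu (@wshift letter @^-1` A) = nu A.

Let flen (om : shift_space) : nat := size (wletter (om 0%N)).

Lemma nu_SigBI (A : set shift_space) : measurable A -> nu (SigB f `&` A) = nu A.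
Proof.
move=> mA; have mS := @measurable_SigB _ f.
rewrite setIC; apply/eqP; rewrite eq_le; apply/andP; split.
  by apply: le_measure; rewrite ?inE //; exact: measurableI.
rewrite -[leRHS]adde0.
have <- : nu (~` SigB f) = 0%E.
  by rewrite probability_setC // nuS subee.
apply: (@le_trans _ _ (nu ((A `&` SigB f) `|` ~` SigB f))).
  apply: le_measure; rewrite ?inE //.
    by apply: measurableU; [exact: measurableI|exact: measurableC].
  by move=> x Ax; have [Sx|nS] := pselect (SigB f x); [left|right].
by apply: measureU2; [exact: measurableI|exact: measurableC].
Qed.

Lemma mean_rho_ge1 : (1 <= mean_rho f nu)%E.
Proof.
have mS := @measurable_SigB _ f.
rewrite -nuS -[leLHS]mul1e -(@integral_cst _ _ _ nu _ mS) /mean_rho.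
have mE : measurable_fun (SigB f : set shift_space) (fun om : shift_space =>
    ((size (wletter (head point (mkseq om 1))))%:R%:E : \bar R)).
  apply: measurable_funTS.
  exact: (@measurable_fun_prefix _ _ (fun w => (size (wletter (head point w)))%:R%:E)).
apply: ge0_le_integral => //.
- by apply: eq_measurable_fun mE => om; rewrite inE => S; rewrite rho_conc.
- move=> om S; rewrite rho_conc // lee_fin ler1n; exact: wletter_size_gt0.
Qed.

(** Level [n] of the tower, restricted to the points whose image under [f^n] has a symbol above [N]
    at position [l]. *)
Let Tset N l n : set shift_space :=
  [set om | (n < flen om)%N] `&` [set om | (N < conc om (n + l))%N].

Let mflen (P : nat -> Prop) : measurable [set om | P (flen om)].
Proof. exact: (@measurable_letter0 (fun e => P (size (wletter e)))). Qed.

Let mTset N l n : measurable (Tset N l n).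
Proof.
by apply: measurableI; [exact: (mflen (fun m => (n < m)%N))|exact: measurable_conc].
Qed.

(** This is the [f]-invariance of the tower measure. Moving one symbol ahead climbs one level,
    except from the top of a column ([Eset n]), which returns to the base; there the invariance of
    [nu] applies. *)
Lemma tower_shift N l :
  (\sum_(0 <= n <oo) nu (Tset N l.+1 n) = \sum_(0 <= n <oo) nu (Tset N l n))%E.
Proof.
pose Eset n := [set om | flen om = n.+1] `&` [set om | (N < conc om (n.+1 + l))%N].
have mE n : measurable (Eset n).
  by apply: measurableI; [exact: (mflen (fun m => m = n.+1))|exact: measurable_conc].
have TE n : nu (Tset N l.+1 n) = (nu (Tset N l n.+1) + nu (Eset n))%E.
  rewrite -measureU //.
    congr (nu _); apply/seteqP; split=> om /=.
      move=> [/= h1 h2]; rewrite addnS -addSn in h2.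
      move: h1; rewrite leq_eqVlt => /orP[/eqP h1|h1]; [right|left]; split=> //.
    by move=> [[/= h1 h2]|[/= h1 h2]]; split; rewrite /= ?addnS -?addSn // ?h1 // ltnW.
  by apply/seteqP; split=> om // [[/= h1 _] [/= h2 _]]; move: h1; rewrite h2 ltnn.
under eq_eseriesr do rewrite TE.
rewrite nneseriesD // [RHS]nneseries_recl // addeC; congr (_ + _)%E; last first.
  by rewrite -(nneseries_addn 1) //; apply: eq_eseriesr => n _; rewrite addn1.
have -> : Tset N l 0 = [set om | (N < conc om l)%N].
  by apply/seteqP; split=> om [] //= h; split=> //; exact: wletter_size_gt0.
(* Dropping the first letter removes exactly [flen] symbols, so the sets [Eset n] partition the
   preimage of the base set under the shift. *)
rewrite -nu_inv; last exact: measurable_conc.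
rewrite -measure_semi_bigcup //.
- congr (nu _); apply/seteqP; split=> om.
    move=> [n _ [/= h1]]; rewrite -h1 /flen -iter_wshiftE wshift_conc //.
  move=> /= h; exists (flen om).-1 => //; rewrite /Eset.
  have -> : (flen om).-1.+1 = flen om by rewrite prednK // wletter_size_gt0.
  by split=> //=; rewrite /flen -iter_wshiftE wshift_conc.
- apply/trivIsetP => i j _ _ /eqP ij; apply/seteqP; split => om //.
  by move=> [[/= hi _] [/= hj _]]; apply: ij; apply: succn_inj; rewrite -hi -hj.
- by apply: bigcupT_measurable.
Qed.

(** By [tower_shift] it is enough to take [l = 0]. Levels above 0 then contribute nothing, since
    every symbol of a letter after its first one is parabolic, hence below [N]. *)
Lemma tower_base N l : (npar f <= N)%N ->
  (\sum_(0 <= n <oo) nu (SigB f `&` Tset N l n) =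
   nu (SigB f `&` [set om | (N < fstletter (om 0%N))%N]))%E.
Proof.
move=> hN; under eq_eseriesr do rewrite nu_SigBI //.
elim: l => [|l IH]; last by rewrite tower_shift.
rewrite nu_SigBI; last exact: (@measurable_letter0 (fun e => (N < fstletter e)%N)).
rewrite nneseries_recl // (_ : Tset N 0 0 = [set om | (N < fstletter (om 0%N))%N]).
  rewrite eseries0 ?adde0 // => n n0 _; rewrite -nu_SigBI //.
  rewrite (_ : SigB f `&` _ = set0) ?measure0 //; apply/seteqP; split => // om [[h _]].
  move=> [/= nf]; rewrite addn0 conc_lt //; move: (h 0%N) nf; rewrite /flen.
  case: (om 0%N) => [i|j i m] /=; first by rewrite ltnS leqNgt n0.
  case: n n0 => // n _ [ip _ m0]; rewrite ltnS size_nseq => nm.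
  by rewrite /= nth_nseq nm ltnNge (leq_trans (ltnW ip) hN).
apply/seteqP; split=> om.
  by move=> [_]; rewrite /= addn0 conc0.
by move=> h; split; rewrite /= ?addn0 ?conc0 //; exact: wletter_size_gt0.
Qed.

(** A coding of a point outside the compact set has a symbol above [N l] at some position [l]. A
    union bound over [l] on each level and an exchange of the two sums leave the quantities
    evaluated by [tower_base]. *)
Lemma mu_of_le (N : nat -> nat) : (forall l, npar f <= N l)%N ->
  (mu_of f nu (Lambda f `\` cpi f @` [set u | forall k, (u k <= N k)%N]) <=
   \sum_(0 <= l <oo) nu (SigB f `&` [set om | (N l < fstletter (om 0%N))%N]))%E.
Proof.
move=> hN; set K := cpi f @` _; set A := _ `\` _.
have cK : closed K by apply: compact_closed; [exact: norm_hausdorff|exact: compact_cpi_bounded].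
have mS := @measurable_SigB _ f.
have levelE k n : SigB f `&` [set om | rho_level f k (conc om)] `&`
      pit f @^-1` (iter n (fL f) @^-1` A) =
    (SigB f `&` [set om | ~ K (cpi f (iter n (@wshift nat) (conc om)))]) `&`
      [set om : shift_space | flen om = k].
  apply/seteqP; split=> om.
    move=> [[S /= /(rho_level_concE k S) rk]]; rewrite /pit /= iter_fL_cpi => -[_ nK].
    by split.
  move=> [[S nK] /= kE]; split; first by split=> //=; apply/rho_level_concE.
  by rewrite /pit /= iter_fL_cpi; split=> //; exists (iter n (@wshift nat) (conc om)).
have mlevel k n : measurable (SigB f `&` [set om | rho_level f k (conc om)] `&`
      pit f @^-1` (iter n (fL f) @^-1` A) : set shift_space).
  rewrite levelE; apply: measurableI; first exact: measurable_cpi_notin.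
  exact: (mflen (fun m => m = k)).
have step n : (\sum_(n.+1 <= k <oo) mut_level f nu k n A <=
    \sum_(0 <= l <oo) nu (SigB f `&` Tset (N l) l n))%E.
  rewrite -nneseries_addn //; under eq_eseriesr do rewrite /mut_level.
  rewrite -measure_semi_bigcup //; last 2 first.
  - apply/trivIsetP => i j _ _ /eqP ij; apply/seteqP; split => om //.
    rewrite !levelE => -[[_ /= hi] [_ /= hj]]; apply: ij.
    by apply: (@addIn n.+1); rewrite -hi -hj.
  - exact: bigcupT_measurable.
  apply: measure_sigma_subadditive => //.
  - by move=> l; exact: measurableI.
  - exact: bigcupT_measurable.
  move=> om [k _]; rewrite levelE => -[[S nK] /= kE].
  have [l Nl] : exists l, ~ (iter n (@wshift nat) (conc om) l <= N l)%N.
    by apply/existsNP => h; apply: nK; exists (iter n (@wshift nat) (conc om)).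
  exists l => //; split=> //; split; first by rewrite /= kE addnS ltnS leq_addl.
  by rewrite /= ltnNge -iter_wshiftE; apply/negP.
(* Return times are at least 1, so the normalising factor is at most 1. For an infinite [mean_rho]
   both [fine] and the inverse return 0. *)
have le1 : (((fine (mean_rho f nu))^-1)%:E <= 1)%E.
  have := mean_rho_ge1; case: (mean_rho f nu) => [r| |] //=.
    by rewrite !lee_fin => r1; rewrite invf_le1 ?(lt_le_trans ltr01).
  by rewrite invr0 lee_fin ler01.
have le0 : (0 <= ((fine (mean_rho f nu))^-1)%:E)%E.
  rewrite lee_fin invr_ge0 fine_ge0 //; apply: le_trans mean_rho_ge1; exact: lee01.
rewrite /mu_of; apply: (@le_trans _ _
  (\sum_(0 <= n <oo) \sum_(n.+1 <= k <oo) mut_level f nu k n A)%E).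
  rewrite -[leRHS]mul1e lee_wpmul2r // nneseries_ge0 // => n _ _.
  by apply: nneseries_ge0.
apply: (@le_trans _ _ (\sum_(0 <= n <oo) \sum_(0 <= l <oo)
    nu (SigB f `&` Tset (N l) l n))%E).
  by apply: lee_nneseries => // n _ _; exact: nneseries_ge0.
rewrite nneseries_interchange //; apply: lee_nneseries => // l _.
  by move=> _; apply: nneseries_ge0.
by rewrite tower_base.
Qed.

End Tower.

(** * Mass of a set of letters *)

Section Sums.
Variable R : realType.

Lemma esum_le_seq (T : choiceType) (S : set T) (a : T -> \bar R) (M : \bar R) :
  (forall s : seq T, uniq s -> {in s, forall x, S x} -> (\sum_(x <- s) a x <= M)%E) ->
  (\esum_(x in S) a x <= M)%E.
Proof.
move=> H; apply: ge_ereal_sup => _ [F [finF FS] <-].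
rewrite fsbig_finite //; apply: H; first exact: finmap.fset_uniq.
by move=> x; rewrite in_fset_set // inE; exact: FS.
Qed.

Lemma seq_le_esum (T : choiceType) (S : set T) (a : T -> \bar R) (s : seq T) :
  uniq s -> {in s, forall x, S x} ->
  (\sum_(x <- s) a x <= \esum_(x in S) a x)%E.
Proof.
move=> us sS; apply: ereal_sup_ubound; exists [set` s].
  by split; [exact: finite_seq|move=> x /= /sS].
by rewrite [RHS]fsbig_seq.
Qed.

Lemma esumZ_le (T : choiceType) (S : set T) (a : T -> \bar R) (c : R) : 0 <= c ->
  (forall x, S x -> 0 <= a x)%E ->
  (\esum_(x in S) (c%:E * a x) <= c%:E * \esum_(x in S) a x)%E.
Proof.
move=> c0 a0; apply: esum_le_seq => s us sS.
rewrite big_seq_cond -ge0_sume_distrr; last by move=> x /andP[xs _]; exact/a0/sS.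
rewrite lee_wpmul2l ?lee_fin // -big_seq_cond; exact: seq_le_esum.
Qed.

Lemma nneseries_pickle (T : countType) (g : T -> \bar R) :
  (forall x, 0 <= g x)%E ->
  (\sum_(0 <= k <oo) (if @pickle_inv T k is Some x then g x else 0) =
   \esum_(x in [set: T]) g x)%E.
Proof.
move=> g0; pose G k := (if @pickle_inv T k is Some x then g x else 0)%E.
have G0 k : (0 <= G k)%E by rewrite /G; case: pickle_inv.
rewrite (nneseries_esumT G0).
transitivity (\esum_(k in range (@pickle T)) G k)%E.
  rewrite [RHS]esum_mkcond; apply: eq_esum => k _; case: ifPn => //.
  rewrite /G; case E : pickle_inv => [x|//]; case/negP; rewrite inE.
  by exists x => //; have := @pickle_invK T k; rewrite E.
rewrite (@reindex_esum R T nat setT (range (@pickle T)) pickle G).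
  by apply: eq_esum => x _; rewrite /G pickleK_inv.
split; first by move=> x _; exists x.
  by move=> x y _ _; apply: (pcan_inj pickleK).
by move=> k [x _ <-]; exists x.
Qed.

Lemma exprn_bound (x Q : R) : 0 <= x -> (forall n, x ^+ n <= Q) -> x <= 1.
Proof.
move=> x0 H; rewrite leNgt; apply/negP => x1.
(* Bernoulli's inequality: the powers are unbounded when [x] exceeds 1. *)
have B n : 1 + n%:R * (x - 1) <= x ^+ n.
  elim: n => [|n IH]; first by rewrite mul0r addr0 expr0.
  rewrite exprS; apply: le_trans (ler_wpM2l x0 IH).
  have n0 : 0 <= n%:R :> R by [].
  have := mulr_ge0 n0 (sqr_ge0 (x - 1)); rewrite -natr1; lra.
have [m mP] : exists m : nat, Q / (x - 1) < m%:R.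
  by exists (Num.truncn (Q / (x - 1))).+1; rewrite truncnS_gt.
have := le_trans (B m) (H m).
by rewrite ltr_pdivrMr ?subr_gt0 // in mP; lra.
Qed.

End Sums.

(** * Eliminating the Gibbs constant from the mass of a set of letters *)

Section Tail.
Variables (R : realType) (nu : probability shift_space R).
Hypothesis nu_inv : forall A : set shift_space, measurable A ->
  nu (@wshift letter @^-1` A) = nu A.
Variables (A : letter -> R) (Q K : R) (E : set letter) (d : R).
Hypothesis A_ge0 : forall e, 0 <= A e.
Hypothesis nu_cyl : forall w : seq letter,
  (nu (cyl setT w) <= (Q * \prod_(e <- w) A e)%:E)%E.
Hypothesis sumA : (\esum_(e in [set: letter]) (A e)%:E <= K%:E)%E.
Hypothesis sumAE : (\esum_(e in E) (A e)%:E <= d%:E)%E.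
Hypothesis d01 : 0 < d < 1.

Let t := - ln d.
(** Along a word the product of [theta] is the exponential of [t] times the number of letters in
    [E]. *)
Let theta (e : letter) : R := if e \in E then d^-1 else 1.

Let d0 : 0 < d. Proof. by case/andP: d01. Qed.

Let Q_ge0 : 0 <= Q.
Proof.
have := nu_cyl [::]; rewrite big_nil mulr1 -lee_fin; exact: le_trans.
Qed.

Let theta_ge0 e : 0 <= theta e.
Proof. by rewrite /theta; case: ifP; rewrite ?invr_ge0 ?ler01 // ltW. Qed.

Let S := K + 1.

(** The weights alone sum to at most [K], and the extra [d^-1 * A e] on [E] adds at most
    [d^-1 * d = 1]. *)
Let sum_theta : (\esum_(e in [set: letter]) (A e * theta e)%:E <= S%:E)%E.
Proof.
have d'0 : 0 <= d^-1 by rewrite invr_ge0 ltW.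
apply: (@le_trans _ _ (\esum_(e in [set: letter])
   ((A e)%:E + (if e \in E then d^-1%:E * (A e)%:E else 0)))%E).
  apply: le_esum => e _; rewrite /theta; case: ifP => _.
    by rewrite -EFinM -EFinD lee_fin mulrC lerDr.
  by rewrite mulr1 adde0.
rewrite esumD; last 2 first.
- by move=> e _; rewrite lee_fin.
- by move=> e _; case: ifP => // _; rewrite lee_fin mulr_ge0.
rewrite /S EFinD; apply: leeD => //.
rewrite -(@esum_mkcond _ _ E (fun e => d^-1%:E * (A e)%:E)%E).
apply: (@le_trans _ _ (d^-1%:E * \esum_(e in E) (A e)%:E)%E).
  by apply: esumZ_le => // e _; rewrite lee_fin.
apply: (@le_trans _ _ (d^-1%:E * d%:E)%E); first by rewrite lee_wpmul2l.
by rewrite -EFinM mulVf // gt_eqF.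
Qed.

Let S0 : 0 <= S.
Proof.
rewrite -lee_fin; apply: le_trans sum_theta; apply: esum_ge0 => e _.
by rewrite lee_fin mulr_ge0.
Qed.

Let Theta n k (om : shift_space) : R := \prod_(j < n) theta (om (k + j)%N).

Let mTheta n k : measurable_fun setT (fun om : shift_space => (Theta n k om)%:E).
Proof.
rewrite (_ : (fun om => _) = (fun om : shift_space =>
  (fun w => (\prod_(j < n) theta (nth point w (k + j)))%:E) (mkseq om (k + n)))).
  exact: (@measurable_fun_prefix _ _
    (fun w => (\prod_(j < n) theta (nth point w (k + j)))%:E)).
apply/funext => om; congr (_%:E); apply: eq_bigr => j _.
by rewrite nth_mkseq // ltn_add2l.
Qed.

Let Theta_ge0 n k om : 0 <= Theta n k om.
Proof. by apply: prodr_ge0. Qed.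

Lemma cyl_cover w : cyl setT w = \bigcup_k
  (if @pickle_inv letter k is Some e then cyl setT (rcons w e) else set0).
Proof.
apply/seteqP; split=> [om [_ ow]|om [k _]].
  exists (pickle (om (size w))); first by [].
  by rewrite pickleK_inv; split; [|rewrite size_rcons mkseqS ow].
case: pickle_inv => // e [_]; rewrite size_rcons mkseqS => /rcons_inj [ow _].
by split.
Qed.

(** Induction on [n] for all words at once: the cylinder of [w] is split by its next letter [e],
    [theta e] is constant on each piece, and the sum of [A e * theta e] costs one factor [S]. *)
Lemma integral_Theta n w :
  (\int[nu]_(om in cyl setT w) (Theta n (size w) om)%:E <=
   (Q * \prod_(e <- w) A e * S ^+ n)%:E)%E.
Proof.
elim: n w => [|n IH] w.
  rewrite expr0 mulr1; apply: le_trans (nu_cyl w).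
  rewrite (eq_integral (cst 1%E)); last by move=> om _; rewrite /Theta big_ord0.
  by rewrite integral_cst ?mul1e //; exact: measurable_cylT.
pose F k : set shift_space :=
  if @pickle_inv letter k is Some e then cyl setT (rcons w e) else set0.
have mF k : measurable (F k).
  by rewrite /F; case: pickle_inv => [e|//]; exact: measurable_cylT.
rewrite (cyl_cover w) ge0_integral_bigcup //; last 3 first.
- exact: measurable_funTS.
- by move=> om _; rewrite lee_fin.
- apply/trivIsetP => i j _ _ ij; apply/seteqP; split => // om [].
  case Ei : (pickle_inv i) => [e|//]; case Ej : (pickle_inv j) => [e'|//].
  move=> [_ h1] [_ h2]; move/eqP: ij; apply.
  have /rcons_inj[ee] : rcons w e = rcons w e' by rewrite -h1 -h2 !size_rcons.
  have := @pickle_invK letter i; have := @pickle_invK letter j.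
  by rewrite Ei Ej /= => <- <-; rewrite ee.
have c0 : 0 <= Q * \prod_(e <- w) A e * S ^+ n.
  by rewrite !mulr_ge0 ?exprn_ge0 // prodr_ge0.
set c := (X in 0 <= X) in c0.
apply: (@le_trans _ _ (\sum_(0 <= k <oo)
  (if @pickle_inv letter k is Some e then c%:E * (A e * theta e)%:E else 0))%E).
  apply: lee_nneseries => [k _ _|k _].
    by apply: integral_ge0 => om _; rewrite lee_fin.
  rewrite /F; case: pickle_inv => [e|]; last by rewrite integral_set0.
  rewrite (eq_integral (fun om => (theta e)%:E *
      (Theta n (size (rcons w e)) om)%:E)%E); last first.
    move=> om; rewrite inE => -[_]; rewrite size_rcons mkseqS => /rcons_inj[_ oe].
    rewrite -EFinM /Theta big_ord_recl addn0 oe; congr (_ * _)%:E.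
    by apply: eq_bigr => j _; rewrite addSnnS.
  rewrite ge0_integralZl_EFin //; last 3 first.
  - exact: measurable_cylT.
  - by move=> om _; rewrite lee_fin.
  - exact: measurable_funTS.
  apply: (@le_trans _ _ ((theta e)%:E *
    (Q * \prod_(e0 <- rcons w e) A e0 * S ^+ n)%:E)%E).
    by rewrite lee_wpmul2l // lee_fin.
  by rewrite -!EFinM lee_fin big_rcons /= /c le_eqVlt; apply/orP; left; apply/eqP; ring.
rewrite (@nneseries_pickle R letter (fun e => c%:E * (A e * theta e)%:E)%E); last first.
  by move=> e; rewrite -EFinM lee_fin mulr_ge0 // mulr_ge0.
apply: le_trans (esumZ_le c0 _) _; first by move=> e _; rewrite lee_fin mulr_ge0.
have -> : (Q * \prod_(e <- w) A e * S ^+ n.+1)%:E = (c%:E * S%:E)%E.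
  by rewrite -EFinM exprSr mulrA.
by rewrite lee_wpmul2l // lee_fin.
Qed.

Let p := fine (nu [set om : shift_space | E (om 0%N)]).

Let mE k : measurable [set om : shift_space | E (om k)].
Proof.
rewrite (_ : [set _ | _] = [set om : shift_space | E (nth point (mkseq om k.+1) k)]).
  exact: (@measurable_prefix (fun w => E (nth point w k)) k.+1).
by apply/seteqP; split=> om /=; rewrite nth_mkseq.
Qed.

Let nu_E k : nu [set om : shift_space | E (om k)] = p%:E.
Proof.
elim: k => [|k IH]; last by rewrite -IH -[RHS]nu_inv.
by rewrite fineK // fin_num_measure.
Qed.

(** Jensen's inequality for the exponential of [t] times the number [X] of visits to [E], whose mean
    is [n * p] by invariance, followed by [integral_Theta] for the empty word. *)
Lemma Jensen_Theta n : (expR (t * p) ^+ n <= Q * S ^+ n).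
Proof.
pose X (om : shift_space) : R := \sum_(j < n) \1_[set om : shift_space | E (om j)] om.
pose c := expR (t * p) ^+ n.
have c0 : 0 < c by rewrite exprn_gt0 // expR_gt0.
have cE : c = expR (n%:R * (t * p)) by rewrite expRM_natl.
have t0 : 0 < t by rewrite oppr_gt0 ln_lt0.
have p0 : 0 <= p by rewrite fine_ge0.
have X0 om : 0 <= X om by apply: sumr_ge0.
have ThetaE om : Theta n 0 om = expR (t * X om).
  rewrite /X mulr_sumr expR_sum; apply: eq_bigr => j _; rewrite add0n /theta.
  have -> : \1_[set om : shift_space | E (om j)] om = (om j \in E)%:R :> R.
    by rewrite indicE; congr (nat_of_bool _)%:R; apply/idP/idP; rewrite !inE.
  by case: ifP => _; rewrite ?mulr1 ?mulr0 ?expR0 // /t expRN lnK.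
have mX : measurable_fun setT (fun om : shift_space => (X om)%:E).
  apply/measurable_EFinP; apply: measurable_sum => j; exact: measurable_indic.
(* The tangent line of the exponential at the mean, where its value is [c]. The negative term is
   moved to the right so that both integrands are nonnegative. *)
have pt om : c + c * t * X om <= Theta n 0 om + c * (n%:R * (t * p)).
  have -> : Theta n 0 om = c * expR (t * X om - n%:R * (t * p)).
    by rewrite cE -expRD ThetaE; congr expR; ring.
  have := expR_ge1Dx (t * X om - n%:R * (t * p)).
  move=> /(ler_wpM2l (ltW c0)); rewrite -lerBlDr; lra.
have intX : (\int[nu]_om (X om)%:E = (n%:R * p)%:E)%E.
  rewrite /X; under eq_integral do rewrite -sumEFin.
  rewrite ge0_integral_sum //; last first.
    by move=> j; apply/measurable_EFinP; exact: measurable_indic.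
  have intj (j : 'I_n) :
      (\int[nu]_om (\1_[set om : shift_space | E (om j)] om)%:E = p%:E)%E.
    rewrite integral_indic; [|exact: measurableT|exact: (mE j)].
    by rewrite -[RHS](nu_E j); congr (nu _); exact: setIT.
  under eq_bigr do rewrite intj.
  by rewrite sumEFin sumr_const card_ord mulr_natl.
have int_cst (r : R) : (\int[nu]_om r%:E = r%:E)%E.
  rewrite integral_cst //= -[RHS]mule1; congr (_ * _)%E; exact: probability_setT.
have ct0 : 0 <= c * t by rewrite mulr_ge0 ?ltW.
have e0 : 0 <= c * (n%:R * (t * p)) by rewrite !mulr_ge0 // ltW.
have : (c%:E + (c * t)%:E * (n%:R * p)%:E <= (Q * S ^+ n)%:E + (c * (n%:R * (t * p)))%:E)%E.
  apply: (@le_trans _ _ (\int[nu]_om ((Theta n 0 om)%:E + (c * (n%:R * (t * p)))%:E))%E).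
    apply: (@le_trans _ _ (\int[nu]_om (c%:E + (c * t)%:E * (X om)%:E))%E).
      rewrite ge0_integralD //.
      - apply: leeD; first by rewrite -[leLHS](int_cst c).
        have X0E om : setT om -> (0 <= (X om)%:E)%E by rewrite lee_fin.
        rewrite (ge0_integralZl_EFin nu measurableT X0E mX ct0).
        by rewrite lee_wpmul2l ?lee_fin // -[leLHS]intX.
      - by move=> om _; rewrite lee_fin ltW.
      - by move=> om _; rewrite -EFinM lee_fin mulr_ge0.
      - by apply: emeasurable_funM => //; exact: measurable_cst.
    apply: ge0_le_integral => //.
    - by move=> om _; rewrite -EFinM -EFinD lee_fin addr_ge0 ?mulr_ge0 // ltW.
    - apply: emeasurable_funD => //; apply: emeasurable_funM => //.
    - by apply: emeasurable_funD.
    - by move=> om _; rewrite -EFinM -!EFinD lee_fin.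
  rewrite (ge0_integralD nu measurableT _ (mTheta n 0)) //; last first.
    by move=> om _; rewrite lee_fin.
  apply: leeD; last by rewrite [leLHS]int_cst.
  have := integral_Theta n [::]; rewrite big_nil mulr1 /=.
  by rewrite (_ : cyl setT [::] = setT) //; apply/seteqP; split=> om.
rewrite -!EFinM -!EFinD lee_fin; rewrite -/c; lra.
Qed.

Lemma tail_bound : p * - ln d <= ln (K + 1).
Proof.
have S1 : 0 < S.
  rewrite lt0r S0 andbT; apply/eqP => SE.
  have := Jensen_Theta 1; rewrite SE expr1 expr1 mulr0 leNgt expR_gt0 //.
(* All powers of this ratio are at most [Q], which forces it to be at most 1 whatever [Q] is. *)
have : expR (t * p) / S <= 1.
  apply: (@exprn_bound _ _ Q); first by rewrite divr_ge0 ?expR_ge0.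
  by move=> n; rewrite expr_div_n ler_pdivrMr ?exprn_gt0 //; exact: Jensen_Theta.
rewrite ler_pdivrMr // mul1r => h.
by rewrite -(expRK (p * _)) ler_ln ?posrE ?expR_gt0 // mulrC.
Qed.

End Tail.

(** * Freely concatenated words *)

Section Blocks.
Variables (R : realType) (nu : probability shift_space R) (T : choiceType).
Variables (blk : T -> seq letter) (y : T -> R) (X : seq T) (C : R) (l : nat).
Hypothesis X_uniq : uniq X.
Hypothesis blk_size : forall x, size (blk x) = l.
Hypothesis blk_inj : {in X &, injective blk}.
Hypothesis y_ge0 : forall x, 0 <= y x.
Hypothesis C_gt0 : 0 < C.
Hypothesis nu_blocks : forall s : seq T, {in s, forall x, x \in X} ->
  ((C * \prod_(x <- s) y x)%:E <= nu (cyl setT (flatten (map blk s))))%E.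

Let B s : set shift_space := cyl setT (flatten (map blk s)).

Let B_rcons s x : B (rcons s x) `<=` B s.
Proof.
move=> om [_]; rewrite map_rcons flatten_rcons size_cat mkseq_cat => h; split=> //.
by move/eqP: h; rewrite eqseq_cat ?size_mkseq // => /andP[/eqP].
Qed.

Let B_disjoint s x x' om : x \in X -> x' \in X ->
  B (rcons s x) om -> B (rcons s x') om -> x = x'.
Proof.
move=> xX x'X [_ h] [_ h']; apply: blk_inj => //; move: h h'.
rewrite !map_rcons !flatten_rcons !size_cat !blk_size => -> /eqP.
by rewrite eqseq_cat // => /andP[_ /eqP].
Qed.

(** Distinct blocks have the same length, so the extensions of [s] by one block have disjoint
    cylinders inside that of [s]; each induction step thus multiplies the bound by the sum of
    [y]. *)
Let blocks_ge k s : {in s, forall x, x \in X} ->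
  ((C * \prod_(x <- s) y x * (\sum_(x <- X) y x) ^+ k)%:E <= nu (B s))%E.
Proof.
elim: k s => [|k IH] s sX; first by rewrite expr0 mulr1; exact: nu_blocks.
have mB t : measurable (B t) by exact: measurable_cylT.
apply: (@le_trans _ _ (nu (\bigcup_(x in [set` X]) B (rcons s x)))); last first.
  apply: le_measure; rewrite ?inE //.
    by apply: fin_bigcup_measurable.
  by move=> om [x _ /B_rcons].
rewrite measure_fin_bigcup //; last first.
  by move=> x x' /= xX x'X [om [h1 h2]]; exact: (B_disjoint xX x'X h1 h2).
rewrite -fsbig_seq //.
apply: (@le_trans _ _ (\sum_(x <- X) (C * \prod_(z <- rcons s x) y z *
    (\sum_(x <- X) y x) ^+ k)%:E)%E).
  rewrite sumEFin lee_fin.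
  under [leRHS]eq_bigr do rewrite big_rcons /= mulrC mulrA mulrA.
  rewrite -mulr_sumr exprSr le_eqVlt; apply/orP; left; apply/eqP; ring.
rewrite big_seq [leRHS]big_seq; apply: lee_sum => x xX; apply: IH => z.
by rewrite mem_rcons inE => /orP[/eqP ->|/sX].
Qed.

(** Total mass 1 bounds every power of the sum by [C^-1], and [exprn_bound] removes this
    constant. *)
Lemma blocks_sum_le1 : \sum_(x <- X) y x <= 1.
Proof.
apply: (@exprn_bound _ _ C^-1); first exact: sumr_ge0.
move=> k; rewrite -[leRHS]mul1r ler_pdivlMr // mulrC -lee_fin.
apply: le_trans (probability_le1 nu (measurable_cylT [::])).
by have := @blocks_ge k [::]; rewrite big_nil mulr1; apply.
Qed.

End Blocks.

(** * Uniform constants *)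

Section Constants.
Variables (R : realType) (f : renyi_map R).

Lemma acceptable_bounded (psi : (nat -> nat) -> R) : acceptable setT psi ->
  exists B : nat -> R, forall u, psi u <= B (u 0%N).
Proof.
move=> [_ osc]; suff H m : exists B : R, forall u, u 0%N = m -> psi u <= B.
  by have [B BP] := choice H; exists B => u; exact: BP.
have mem u : u 0%N = m -> cyl setT [:: m] u by move=> um; split=> //=; rewrite /mkseq /= um.
set S := ereal_sup [set (psi t)%:E | t in cyl setT [:: m]].
set I := ereal_inf [set (psi t)%:E | t in cyl setT [:: m]].
have IS : (S - I < +oo)%E.
  by apply: le_lt_trans osc; apply: ereal_sup_ubound; exists m.
have psiS u : u 0%N = m -> ((psi u)%:E <= S)%E.
  by move=> /mem mu; apply: ereal_sup_ubound; exists u.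
have Ioo : (I < +oo)%E.
  apply: le_lt_trans (ltry (psi (fun=> m))).
  by apply: ereal_inf_lbound; exists (fun=> m) => //; exact: mem.
(* The infimum is below [+oo], so a supremum equal to [+oo] would make the oscillation infinite. *)
have : S != +oo%E.
  by apply/eqP => Soo; move: IS Ioo; rewrite Soo; case: I => [r| |].
move=> {IS}; case: S psiS => [r| |] // psiS _; first by exists r => u /psiS.
by exists 0 => u /psiS.
Qed.

Lemma dfn1E (u : nat -> nat) : dfn f 1 u = derive1 (fb f (u 0%N)) (cpi f u).
Proof. by []. Qed.

Lemma dfn1_bounded : exists B : nat -> R, forall u,
  1 <= `|dfn f 1 u| <= B (u 0%N).
Proof.
have H i : exists B, forall x, x \in `[dl f i, dr f i] ->
    `|derive1 (fb f i) x| <= B by have [B _] := @dfb_bounded _ f i; exists B.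
have [B BP] := choice H; exists B => u.
by rewrite dfn1E dfb_ge1 ?BP ?cpi_itv.
Qed.

(** The distance is at most 1, so its power with exponent [- beta] is at least 1 and the Hoelder
    quotient dominates the difference. *)
Lemma holder_letter_osc (S : set (nat -> letter)) (psi : (nat -> letter) -> R)
    (beta : R) : 0 < beta -> locally_holder S psi beta ->
  exists D : R, forall t u, S t -> S u -> t 0%N = u 0%N ->
    `|psi t - psi u| <= D.
Proof.
move=> b0 [D DP]; exists (Num.max 0 D).
move=> t u St Su tu; rewrite le_max; have [->|ntu] := pselect (t = u).
  by rewrite subrr normr0 lexx.
apply/orP; right; apply: le_trans (DP t u St Su tu ntu).
rewrite ler_peMr //.
rewrite /dshift asboolF // /powR gt_eqF ?expR_gt0 // expRK mulrNN.
by rewrite -expR0 ler_expR mulr_ge0 // ltW.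
Qed.

Lemma ereal_inf_gt0 (phi : R -> R) (L : set R) :
  (0 < ereal_inf [set (phi x)%:E | x in L])%E -> forall x, L x -> 0 <= phi x.
Proof.
move=> h x Lx; rewrite -lee_fin; apply: le_trans (ltW h) _.
by apply: ereal_inf_lbound; exists x.
Qed.

End Constants.

(** * The induced potential *)

Section RealBounds.
Variable R : realType.
Implicit Types x y a g p q b l s n M D L B : R.

Lemma mul_norm_bound q M x B : `|q| <= M -> `|x| <= B -> - (M * B) <= q * x <= M * B.
Proof. by move=> qM xB; rewrite -ler_norml normrM ler_pM. Qed.

(** Used with [x], [y] the logarithms of the induced derivative at two points, [a], [a'] those of
    the derivative of [f], [g] the common term [(1 + gam) * ln n], and [L = ln C]. *)
Lemma norm_diff_shift x y a a' g L B : `|x - (a + g)| <= L ->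
  `|y - (a' + g)| <= L -> 0 <= a <= B -> 0 <= a' <= B ->
  `|x - y| <= 2 * L + B.
Proof.
move=> /ler_normlP[h1 h2] /ler_normlP[h3 h4] /andP[h5 h6] /andP[h7 h8].
by apply/ler_normlP; split; lra.
Qed.

Lemma norm_diff_affine q b s n p p' l l' M D L : `|q| <= M -> `|b| <= M ->
  `|p - p'| <= D -> `|l - l'| <= L ->
  `|(- q * p - b * l - s * n) - (- q * p' - b * l' - s * n)| <= M * (D + L).
Proof.
move=> qM bM /(mul_norm_bound qM)/andP[h1 h2] /(mul_norm_bound bM)/andP[h3 h4].
by apply/ler_normlP; split; lra.
Qed.

(** The terms in [q] match exactly, while [l - a] and [l' - a'] are both within [L] of the same
    [g]. *)
Lemma affine_replace q b s n p p' l l' f f' a a' g M L : `|b| <= M ->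
  p - p' = f - f' -> `|l - (a + g)| <= L -> `|l' - (a' + g)| <= L ->
  - q * p - b * l - s * n <=
  (- q * f - b * a) - (- q * f' - b * a') + 2 * M * L + (- q * p' - b * l' - s * n).
Proof.
move=> bM pf /ler_normlP[h1 h2] /ler_normlP[h3 h4].
have : `|(l - a) - (l' - a')| <= 2 * L by apply/ler_normlP; split; lra.
move=> /(mul_norm_bound bM)/andP[h5 h6].
have : q * (p - p') = q * (f - f') by rewrite pf.
lra.
Qed.

(** The estimate [ln n <= n] makes the growth of the derivative at most linear, so that a large [s]
    can outweigh all terms of order [n]. *)
Lemma affine_upper q b s n p l a g L B B' P G M : `|q| <= M -> `|b| <= M ->
  `|l - (a + g * ln n)| <= L -> 0 <= a <= B -> 1 <= n -> `|p| <= B' + n * P ->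
  `|g| <= G -> 
  - q * p - b * l - s * n <= M * (B' + L + B) + n * (M * (P + G) - s).
Proof.
move=> qM bM /ler_normlP[h1 h2] /andP[a0 a1] n1 pB gG.
have /andP[h3 h4] := mul_norm_bound qM pB.
have /andP[z0 z1] : 0 <= ln n <= n.
  have n0 : 0 < n by exact: lt_le_trans n1.
  rewrite ln_ge0 //=; have := expR_ge1Dx (ln n); rewrite lnK //; lra.
have /andP[h5 h6] : - (G * n) <= g * ln n <= G * n.
  by apply: mul_norm_bound => //; rewrite ger0_norm.
have lB : `|l| <= L + B + G * n by apply/ler_normlP; split; lra.
have /andP[h7 h8] := mul_norm_bound bM lB.
lra.
Qed.

End RealBounds.

(** * Distortion and size of the induced potential on a letter *)

Section Potential.
Variables (R : realType) (f : renyi_map R) (phi : R -> R).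
Variables (M D C gam : R) (phiB dB : nat -> R).
Hypothesis phi_bd : forall u, 0 <= phi (cpi f u) <= phiB (u 0%N).
Hypothesis d_bd : forall u, 1 <= `|dfn f 1 u| <= dB (u 0%N).
Hypothesis C_ge1 : 1 <= C.
Hypothesis adm : forall n u, rho_level f n u ->
  C^-1 <= `|dfind f u| / (`|dfn f 1 u| * n%:R `^ (1 + gam)) <= C.
Hypothesis phit_osc : forall om om', SigB f om -> SigB f om' ->
  om 0%N = om' 0%N -> `|phit f phi (conc om) - phit f phi (conc om')| <= D.
Variables (b q s : R).
Hypotheses (bM : `|b| <= M) (qM : `|q| <= M).
Implicit Types (om : nat -> letter) (u : nat -> nat).

Lemma ln_dfn1_bound u : 0 <= ln `|dfn f 1 u| <= ln (dB (u 0%N)).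
Proof.
have /andP[d1 d2] := d_bd u; rewrite ln_ge0 //= ler_ln // posrE.
  exact: lt_le_trans d1.
by apply: lt_le_trans (le_trans d1 d2).
Qed.

Definition psi_bound i := M * (phiB i + ln (dB i)).

Lemma psi_bq_bound u : `|psi_bq f phi b q u| <= psi_bound (u 0%N).
Proof.
have /andP[p0 p1] := phi_bd u; have /andP[l0 l1] := ln_dfn1_bound u.
have /andP[h1 h2] : - (M * phiB (u 0%N)) <= q * phi (cpi f u) <= M * phiB (u 0%N).
  by apply: mul_norm_bound => //; rewrite ger0_norm.
have /andP[h3 h4] : - (M * ln (dB (u 0%N))) <= b * ln `|dfn f 1 u| <= M * ln (dB (u 0%N)).
  by apply: mul_norm_bound => //; rewrite ger0_norm.
by rewrite /psi_bq /psi_bound ler_norml; apply/andP; split; lra.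
Qed.

Lemma pot_LetH om i : SigB f om -> om 0%N = LetH i ->
  pot f phi b q s om = psi_bq f phi b q (conc om) - s.
Proof.
move=> S o0; rewrite /pot phitE // /dfind rho_conc // o0 /= big_ord_recl big_ord0.
by rewrite addr0 mulr1.
Qed.

Lemma ln_dfind_bound om : SigB f om ->
  `|ln `|dfind f (conc om)| - (ln `|dfn f 1 (conc om)| +
     (1 + gam) * ln (size (wletter (om 0%N)))%:R)| <= ln C.
Proof.
move=> S; have /adm := rho_level_conc S; set n := size _; set x := `|dfind _ _|.
have n0 : 0 < n%:R :> R by rewrite ltr0n wletter_size_gt0.
have d0 : 0 < `|dfn f 1 (conc om)|.
  by apply: lt_le_trans (_ : 0 < 1) _ => //; have /andP[] := d_bd (conc om).
have p0 : 0 < n%:R `^ (1 + gam) by rewrite powR_gt0.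
have C0 : 0 < C by apply: lt_le_trans C_ge1.
move=> /andP[h1 h2].
have y0 : 0 < `|dfn f 1 (conc om)| * n%:R `^ (1 + gam) by rewrite mulr_gt0.
have x0 : 0 < x.
  have : 0 < x / (`|dfn f 1 (conc om)| * n%:R `^ (1 + gam)).
    by apply: lt_le_trans h1; rewrite invr_gt0.
  by rewrite pmulr_lgt0 // invr_gt0.
rewrite -ln_powR -lnM ?posrE // -ln_div ?posrE // ler_norml -lnV ?posrE //.
by rewrite !ler_ln ?posrE ?invr_gt0 ?divr_gt0 // h1 h2.
Qed.

(** The return time depends only on the first letter, so the term in [s] cancels and the bound is
    uniform in [s]. Derivatives at two points of a letter are compared through admissibility. *)
Lemma pot_osc om om' : SigB f om -> SigB f om' -> om 0%N = om' 0%N ->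
  `|pot f phi b q s om - pot f phi b q s om'| <=
     M * (D + 2 * ln C + ln (dB (fstletter (om 0%N)))).
Proof.
move=> S S' eo; have e1 := ln_dfind_bound S; have e2 := ln_dfind_bound S'.
have l1 := ln_dfn1_bound (conc om); have l2 := ln_dfn1_bound (conc om').
rewrite conc0 in l1; rewrite conc0 -eo in l2; rewrite -eo in e2.
rewrite /pot !rho_conc // -eo -[D + _ + _]addrA; apply: norm_diff_affine => //.
  exact: phit_osc.
exact: norm_diff_shift e1 e2 l1 l2.
Qed.

Lemma SigB_replace om m i n h : SigB f om -> om 0%N = LetA m i n -> h <> i ->
  SigB f (fun k => if k is 0%N then LetA h i n else om k).
Proof.
move=> [isl fol] o0 hi; split=> [[|k]|[|k]] //=.
- by have := isl 0%N; rewrite o0 => -[].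
- by have := fol 0%N; rewrite o0.
Qed.

(* Both codings have the same image under f, so the sums defining phit differ
   only in their first term. *)
Lemma pot_replace om m i n h : SigB f om -> om 0%N = LetA m i n -> h <> i ->
  forall om', om' = (fun k => if k is 0%N then LetA h i n else om k) ->
  pot f phi b q s om <= psi_bq f phi b q (conc om) - psi_bq f phi b q (conc om') +
    2 * M * ln C + pot f phi b q s om'.
Proof.
move=> S o0 hi om' om'E.
have S' : SigB f om' by rewrite om'E; exact: SigB_replace S o0 hi.
have o0' : om' 0%N = LetA h i n by rewrite om'E.
have o1' : @wshift letter om' = @wshift letter om by rewrite om'E.
have sz : size (wletter (om' 0%N)) = size (wletter (om 0%N)) by rewrite o0 o0'.
have tl : wshift (conc om) = wshift (conc om').
  apply/funext => k; rewrite /wshift conc_wshift [RHS]conc_wshift sz o1' o0 o0'.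
  by case: ltnP; case: k.
have ph : phit f phi (conc om) - phit f phi (conc om') =
    phi (cpi f (conc om)) - phi (cpi f (conc om')).
  rewrite !phitE // sz.
  have [N ->] : exists N, size (wletter (om 0%N)) = N.+1.
    by exists (size (wletter (om 0%N))).-1; rewrite prednK // wletter_size_gt0.
  rewrite !big_ord_recl; under eq_bigr do rewrite lift0 iterSr tl -iterSr -lift0.
  by rewrite opprD addrACA subrr addr0.
have e1 := ln_dfind_bound S; have e2 := ln_dfind_bound S'; rewrite sz in e2.
rewrite /pot !rho_conc // sz /psi_bq; exact: affine_replace ph e1 e2.
Qed.

(** This is the bound behind the geometric series for large [s]. After the first symbol [m], the
    other [n - 1] points of the orbit before the return have first symbol [i], where [phi] is at
    most [P]. *)
Lemma pot_LetA_le om m i n (P : R) : SigB f om -> om 0%N = LetA m i n ->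
  phiB i <= P ->
  pot f phi b q s om <= M * (phiB m + ln C + ln (dB m)) +
    n%:R * (M * (P + `|1 + gam|) - s).
Proof.
move=> S o0 iP; have [isl _] := S; have := isl 0%N; rewrite o0 => -[ip mi n0].
have sz : size (wletter (om 0%N)) = n by rewrite o0 /= size_nseq prednK.
have P0 : 0 <= P.
  by apply: le_trans iP; have /andP[] := phi_bd (fun=> i); exact: le_trans.
have ph : `|phit f phi (conc om)| <= phiB m + n%:R * P.
  rewrite phitE // ger0_norm; last first.
    by apply: sumr_ge0 => k _; have /andP[] := phi_bd (iter k (@wshift nat) (conc om)).
  rewrite sz -(prednK n0) big_ord_recl; apply: lerD.
    by have /andP[_] := phi_bd (conc om); rewrite conc0 o0.
  apply: (@le_trans _ _ (\sum_(k < n.-1) P)).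
    apply: ler_sum => k _; have /andP[_] := phi_bd (iter (lift ord0 k) (@wshift nat) (conc om)).
    rewrite iter_wshiftE addn0 conc_lt ?sz; last first.
      by rewrite /lift /= /bump /= add1n -[ltnRHS](prednK n0) ltnS.
    by rewrite o0 /= nth_nseq ltn_ord => /le_trans; apply.
  by rewrite sumr_const card_ord -[P *+ _]mulr_natl ler_wpM2r // ler_nat leqnSn.
have l1 := ln_dfn1_bound (conc om); rewrite conc0 o0 /= in l1.
have e1 := ln_dfind_bound S; rewrite sz in e1.
rewrite /pot rho_conc // sz; apply: affine_upper e1 l1 _ ph _ => //.
by rewrite ler1n.
Qed.

End Potential.

(** * Sums over letters *)

Section LetterSums.
Variable R : realType.

(** With [fstletter] it identifies the alphabet with a product, so a weight that is a product over
    the two components sums to a product of sums. *)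
Definition restletter (e : letter) : option (nat * nat) :=
  match e with LetH _ => None | LetA _ i n => Some (i, n) end.

Lemma esum_letter (F : set nat) (a : nat -> R) (c : option (nat * nat) -> R)
    (al ka : R) : 0 <= al -> (forall m, 0 <= a m) -> (forall o, 0 <= c o) ->
  (\esum_(m in F) (a m)%:E <= al%:E)%E ->
  (\esum_(o in [set: option (nat * nat)]) (c o)%:E <= ka%:E)%E ->
  (\esum_(e in [set e | F (fstletter e)])
     (a (fstletter e) * c (restletter e))%:E <= (al * ka)%:E)%E.
Proof.
move=> al0 a0 c0 aF cK.
rewrite (@reindex_esum R _ _ (F `*`` (fun _ => [set: option (nat * nat)]))
  [set e | F (fstletter e)] (fun p => match p.2 with
    | None => LetH p.1 | Some (i, n) => LetA p.1 i n end)); last first.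
  split.
  - by move=> [m [[i n]|]] [/= Fm _].
  - by move=> [m [[i n]|]] [m' [[i' n']|]] _ _ //=; congruence.
  - by move=> [m|m i n] /= Fm; [exists (m, None)|exists (m, Some (i, n))].
rewrite (eq_esum (b := fun p => (a p.1)%:E * (c p.2)%:E)%E); last first.
  by move=> [m [[i n]|]] _ /=; rewrite EFinM.
rewrite -(@esum_esum R _ _ F (fun=> setT) (fun m o => (a m)%:E * (c o)%:E)%E);
  last by move=> m o _ _; rewrite -EFinM lee_fin mulr_ge0.
have ka0 : 0 <= ka.
  by rewrite -lee_fin; apply: le_trans cK; apply: esum_ge0 => o _; rewrite lee_fin.
apply: (@le_trans _ _ (\esum_(m in F) (ka%:E * (a m)%:E))%E).
  apply: le_esum => m _.
  apply: le_trans (@esumZ_le R _ setT (fun o => (c o)%:E) _ (a0 m) _) _.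
    by move=> o _; rewrite lee_fin.
  by rewrite [leRHS]muleC lee_wpmul2l ?lee_fin.
apply: le_trans (@esumZ_le R _ F (fun m => (a m)%:E) _ ka0 _) _.
  by move=> m _; rewrite lee_fin.
by rewrite mulrC EFinM lee_wpmul2l ?lee_fin.
Qed.

Lemma esum_option (T : choiceType) (c : option T -> R) (K : R) :
  (forall o, 0 <= c o) -> (\esum_(x in [set: T]) (c (Some x))%:E <= K%:E)%E ->
  (\esum_(o in [set: option T]) (c o)%:E <= (c None + K)%:E)%E.
Proof.
move=> c0 cK; rewrite (@esumID _ _ [set None]); last by move=> o _; rewrite lee_fin.
rewrite !setTI EFinD; apply: leeD; first by rewrite esum_set1 ?lee_fin.
rewrite (@reindex_esum R _ _ [set: T] (~` [set None]) Some) //; split.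
- by [].
- by move=> x y _ _ [].
- by move=> [x|] //= _; exists x.
Qed.

Lemma esum_geometric2 (g : R) : 0 <= g ->
  (\esum_(p in [set: nat * nat]) (g * 2^-1 ^+ p.1 * 2^-1 ^+ p.2)%:E <= (4 * g)%:E)%E.
Proof.
move=> g0.
have h0 k : 0 <= 2^-1 ^+ k :> R by rewrite exprn_ge0 // invr_ge0.
have half : (\esum_(k in [set: nat]) (2^-1 ^+ k)%:E <= 2%:E :> \bar R)%E.
  rewrite -nneseries_esumT; last by move=> k; rewrite lee_fin.
  (* With total 2 the terms [2 / 2 ^ k.+1] are exactly the powers of [2^-1]. *)
  apply: le_trans (@epsilon_trick0 R 2 xpredT _) => //.
  apply: lee_nneseries => k *; rewrite lee_fin //.
  by rewrite natrX exprS invfM mulrA divff // mul1r exprVn.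
rewrite (_ : [set: nat * nat] = [set: nat] `*`` (fun=> [set: nat])); last first.
  by apply/seteqP; split => // -[].
rewrite -(@esum_esum R _ _ setT (fun=> setT)
  (fun i n => (g * 2^-1 ^+ i * 2^-1 ^+ n)%:E)); last first.
  by move=> i n _ _; rewrite lee_fin !mulr_ge0.
apply: (@le_trans _ _ (\esum_(i in [set: nat]) ((2 * g)%:E * (2^-1 ^+ i)%:E))%E).
  apply: le_esum => i _.
  have gi0 : 0 <= g * 2^-1 ^+ i by rewrite mulr_ge0.
  under eq_esum do rewrite EFinM.
  apply: le_trans (@esumZ_le R _ setT (fun n => (2^-1 ^+ n)%:E) _ gi0 _) _.
    by move=> n _; rewrite lee_fin.
  have -> : ((2 * g)%:E * (2^-1 ^+ i)%:E = (g * 2^-1 ^+ i)%:E * 2%:E)%E.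
    by rewrite -!EFinM; congr (_%:E); ring.
  by rewrite lee_wpmul2l ?lee_fin.
have g20 : 0 <= 2 * g by rewrite mulr_ge0.
apply: le_trans (@esumZ_le R _ setT (fun n => (2^-1 ^+ n)%:E) _ g20 _) _.
  by move=> n _; rewrite lee_fin.
have -> : (4 * g)%:E = ((2 * g)%:E * 2%:E)%E by rewrite -EFinM; congr (_%:E); ring.
by rewrite lee_wpmul2l ?lee_fin.
Qed.

End LetterSums.

(** * Gibbs bounds *)

Section GibbsCylinders.
Variables (R : realType) (f : renyi_map R) (nu : probability shift_space R).
Variables (V : (nat -> letter) -> R) (P Q : R).
Hypothesis nuS : nu (SigB f) = 1%E.
Hypothesis Q_ge1 : 1 <= Q.
Hypothesis gibbs : forall (w : seq letter) (om : nat -> letter),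
  admissible_word f w -> cyl (SigB f) w om ->
  Q^-1 <= fine (nu (cyl (SigB f) w)) /
          expR (birkhoff (size w) V om - (size w)%:R * P) <= Q.
Implicit Types (w : seq letter) (om : nat -> letter).

Let Q_gt0 : 0 < Q. Proof. exact: lt_le_trans Q_ge1. Qed.

Lemma SigB_iter k om : SigB f om -> SigB f (iter k (@wshift letter) om).
Proof. by move=> S; elim: k => //= k; exact: SigB_wshift. Qed.

Lemma cyl_nth w om k : cyl (SigB f) w om -> (k < size w)%N -> nth point w k = om k.
Proof. by move=> [_ ow] kw; rewrite -[in LHS]ow nth_mkseq. Qed.

Lemma cyl_admissible w om : cyl (SigB f) w om -> admissible_word f w.
Proof.
move=> ow; have [[h1 h2] _] := ow; split=> k kw; first by rewrite (cyl_nth ow).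
by rewrite !(cyl_nth ow) // ltnW.
Qed.

Lemma nu_cyl_SigB w : nu (cyl setT w) = nu (cyl (SigB f) w).
Proof.
rewrite -(@nu_SigBI R f nu nuS); last exact: measurable_cylT.
by congr (nu _); apply/seteqP; split=> om [] //= ? [].
Qed.

Lemma prod_cyl (A : letter -> R) w om : cyl (SigB f) w om ->
  \prod_(e <- w) A e = \prod_(k < size w) A (om k).
Proof.
move=> ow; rewrite (big_nth point) big_mkord; apply: eq_bigr => k _.
by rewrite (cyl_nth ow).
Qed.

Lemma birkhoff_weight n om : expR (birkhoff n V om - n%:R * P) =
  \prod_(k < n) expR (V (iter k (@wshift letter) om) - P).
Proof.
by rewrite -expR_sum sumrB sumr_const card_ord mulr_natl.
Qed.

(** The Gibbs inequality needs a point of the cylinder, over which the exponential of the Birkhoff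
    sum factors letter by letter; an empty cylinder has mass 0. *)
Lemma gibbs_upper (A : letter -> R) w : (forall e, 0 <= A e) ->
  (forall om, SigB f om -> expR (V om - P) <= A (om 0%N)) ->
  (nu (cyl setT w) <= (Q * \prod_(e <- w) A e)%:E)%E.
Proof.
move=> A0 VA; rewrite nu_cyl_SigB.
have [[om ow]|none] := pselect (cyl (SigB f) w !=set0); last first.
  rewrite (_ : cyl (SigB f) w = set0) ?measure0.
    by rewrite lee_fin mulr_ge0 ?prodr_ge0 // ltW.
  by apply/seteqP; split => // om ow; apply: none; exists om.
have /andP[_] := gibbs (cyl_admissible ow) ow.
rewrite ler_pdivrMr ?expR_gt0 // birkhoff_weight => h.
have fm := fin_num_measure nu _ (measurable_cyl_SigB f w).
rewrite -(fineK fm) lee_fin.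
apply: le_trans h _; rewrite ler_wpM2l ?(ltW Q_gt0) // (prod_cyl A ow).
apply: ler_prod => k _; rewrite expR_ge0 /=.
have [S _] := ow; have := VA _ (SigB_iter k S).
by rewrite iter_wshiftE addn0.
Qed.

(** The bound [L] is asked only of letters of [w], because later it is available only for letters
    occurring in loops. *)
Lemma gibbs_lower (L : letter -> R) w om :
  (forall om, SigB f om -> om 0%N \in w -> L (om 0%N) <= V om - P) ->
  cyl (SigB f) w om ->
  ((Q^-1 * \prod_(e <- w) expR (L e))%:E <= nu (cyl setT w))%E.
Proof.
move=> VL ow; rewrite nu_cyl_SigB.
have /andP[+ _] := gibbs (cyl_admissible ow) ow.
rewrite ler_pdivlMr ?expR_gt0 // birkhoff_weight => h.
have fm := fin_num_measure nu _ (measurable_cyl_SigB f w).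
rewrite -(fineK fm) lee_fin.
apply: le_trans h; rewrite ler_wpM2l ?invr_ge0 ?(ltW Q_gt0) //.
rewrite (prod_cyl (fun e => expR (L e)) ow).
apply: ler_prod => k _; rewrite expR_ge0 /= ler_expR.
have [S _] := ow; have := VL _ (SigB_iter k S).
rewrite iter_wshiftE addn0; apply.
by rewrite -(cyl_nth ow (ltn_ord k)) mem_nth.
Qed.

End GibbsCylinders.

(** * Uniformly summable weights on the induced alphabet *)

Section Weights.
Variables (R : realType) (f : renyi_map R) (phi : R -> R).
Variables (M D C gam : R) (phiB dB : nat -> R).
Hypothesis phi_bd : forall u, 0 <= phi (cpi f u) <= phiB (u 0%N).
Hypothesis d_bd : forall u, 1 <= `|dfn f 1 u| <= dB (u 0%N).
Hypothesis C_ge1 : 1 <= C.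
Hypothesis adm : forall n u, rho_level f n u ->
  C^-1 <= `|dfind f u| / (`|dfn f 1 u| * n%:R `^ (1 + gam)) <= C.
Hypothesis phit_osc : forall om om', SigB f om -> SigB f om' ->
  om 0%N = om' 0%N -> `|phit f phi (conc om) - phit f phi (conc om')| <= D.
Variables (b q s : R).
Hypotheses (bM : `|b| <= M) (qM : `|q| <= M).
Variables (nu : probability shift_space R) (P Q MP B : R).
Hypothesis nuS : nu (SigB f) = 1%E.
Hypothesis Q_ge1 : 1 <= Q.
Hypothesis gibbs : forall (w : seq letter) (om : nat -> letter),
  admissible_word f w -> cyl (SigB f) w om ->
  Q^-1 <= fine (nu (cyl (SigB f) w)) /
          expR (birkhoff (size w) (pot f phi b q s) om - (size w)%:R * P) <= Q.
Hypothesis P_bd : `|P| <= MP.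
Hypothesis par_phi : forall i, (i < npar f)%N -> phiB i <= B.
Hypothesis par_psi : forall i, (i < npar f)%N -> psi_bound M phiB dB i <= B.
Implicit Types (om : nat -> letter) (u : nat -> nat).

Let V := pot f phi b q s.
(** The least hyperbolic index, used as the fixed first symbol. *)
Let h := npar f.
Let osc := M * (D + 2 * ln C + ln (dB h)).

Let h_neq i : (i < npar f)%N -> h <> i.
Proof. by move=> ih e; move: ih; rewrite -e ltnn. Qed.

Definition scons (e : letter) om : nat -> letter :=
  fun k => if k is k'.+1 then om k' else e.

Lemma SigB_scons e om : SigB f om -> is_letter f e -> follows f e (om 0%N) ->
  SigB f (scons e om).
Proof. by move=> [h1 h2] le fe; split=> -[|k] //=. Qed.

(* The words h i^n A_i, iH can be concatenated freely as h is hyperbolic. *)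
Definition loop (p : nat * nat) : seq letter := [:: LetA h p.1 p.2; LetH p.1].

(** The constant tail [LetH h] is admissible and starts with the hyperbolic [h], so any loop may
    precede it; this gives a point in the cylinder of every concatenation. *)
Definition loops (t : seq (nat * nat)) : nat -> letter :=
  foldr (fun p om => scons (LetA h p.1 p.2) (scons (LetH p.1) om)) (fun=> LetH h) t.

Definition good_pair (p : nat * nat) := (p.1 < npar f)%N && (0 < p.2)%N.

Lemma loops_SigB t : {in t, forall p, good_pair p} -> SigB f (loops t).
Proof.
have fstE t' : fstletter (loops t' 0%N) = h by case: t'.
elim: t => [_|p t IH gt]; first by split=> k //=; exact: leqnn.
have /andP[ip n0] : good_pair p by apply: gt; rewrite mem_head.
apply: SigB_scons; first (apply: SigB_scons => //).
- by apply: IH => z zt; apply: gt; rewrite inE zt orbT.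
- by rewrite /hyperbolic /= fstE; exact: leqnn.
- by split=> //; exact: h_neq.
- by split=> //= e; move: ip; rewrite ltnNge e.
Qed.

Lemma loops_cyl t : {in t, forall p, good_pair p} ->
  cyl (SigB f) (flatten (map loop t)) (loops t).
Proof.
move=> gt; split; first exact: loops_SigB.
elim: t {gt} => //= p t IH; rewrite !mkseqSl /=; congr [:: _, _ & _].
exact: IH.
Qed.

Let loop_point p := loops [:: p].

Lemma loop_point_SigB p : good_pair p -> SigB f (loop_point p).
Proof. by move=> gp; apply: loops_SigB => z; rewrite inE => /eqP ->. Qed.

(** The weight r(i,n), evaluated at one reference point of the letter. Pairs that give no letter get
    weight 0. *)
Definition loop_weight (p : nat * nat) : R :=
  if good_pair p then expR (V (loop_point p) - P) else 0.

Lemma loop_weight_ge0 p : 0 <= loop_weight p.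
Proof. by rewrite /loop_weight; case: ifP => // _; exact: expR_ge0. Qed.

Lemma V_loop_osc om p : SigB f om -> om 0%N = LetA h p.1 p.2 -> good_pair p ->
  `|V om - V (loop_point p)| <= osc.
Proof.
move=> S o0 gp; have := pot_osc d_bd C_ge1 adm phit_osc s bM qM S (loop_point_SigB gp).
by rewrite o0 => /(_ erefl).
Qed.

(** When [s] is bounded above, the closing letter [iH] has weight bounded below, so a loop weighs as
    much as [h i^n A_i] up to a constant and [blocks_sum_le1] applies. *)
Lemma sum_loop_weight_small : s <= M * (B + `|1 + gam|) + 1 ->
  (\esum_(p in [set: nat * nat]) (loop_weight p)%:E <=
   (expR (osc + MP + B + (M * (B + `|1 + gam|) + 1)))%:E)%E.
Proof.
set s0 := _ + 1 => ss0; set K := expR _.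
apply: esum_le_seq => X uX _.
have [P1 P2] := ler_normlP _ _ P_bd.
(* [K] absorbs the oscillation on [h i^n A_i] and the least possible weight [expR (- B - s0 - P)] of
   [iH], using [P <= MP]. *)
pose y p := K^-1 * loop_weight p.
suff Y : \sum_(p <- [seq p <- X | good_pair p]) y p <= 1.
  rewrite sumEFin lee_fin.
  rewrite (bigID good_pair) /= [X in _ + X]big1 ?addr0; last first.
    by move=> p /negbTE np; rewrite /loop_weight np.
  rewrite -big_filter; move: Y; rewrite -mulr_sumr mulrC.
  by rewrite ler_pdivrMr ?expR_gt0 // mul1r.
pose L e : R := match e with
  | LetA _ i n => V (loop_point (i, n)) - osc - P
  | LetH i => - B - s0 - P end.
have Q0 : 0 < Q by exact: lt_le_trans Q_ge1.
apply: (@blocks_sum_le1 R nu _ loop y _ Q^-1 2) => //.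
- exact: filter_uniq.
- by move=> [i n] [i' n'] _ _ [-> ->].
- by move=> p; rewrite mulr_ge0 ?loop_weight_ge0 // invr_ge0 expR_ge0.
- by rewrite invr_gt0.
move=> t tX.
have gt : {in t, forall p, good_pair p}.
  by move=> p /tX; rewrite mem_filter => /andP[].
apply: le_trans (@gibbs_lower R f nu V P Q nuS Q_ge1 gibbs L _ _ _ (loops_cyl gt)).
  rewrite lee_fin ler_wpM2l ?invr_ge0 ?(ltW Q0) // big_flatten big_map /=.
  rewrite !big_seq; apply: ler_prod => p /gt gp; apply/andP; split.
    by rewrite mulr_ge0 ?loop_weight_ge0 // invr_ge0 expR_ge0.
  rewrite /loop !big_cons big_nil mulr1 /y /loop_weight gp -expRN -!expRD ler_expR /=.
  by rewrite -surjective_pairing; lra.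
move=> om S; case/flatten_mapP => p /gt gp; rewrite !inE => /orP[/eqP o0|/eqP o0].
  rewrite o0 /= -surjective_pairing.
  have /ler_normlP[] := V_loop_osc S o0 gp; lra.
rewrite o0 /= /V (pot_LetH phi b q s S o0).
have /ler_normlP[] := psi_bq_bound phi_bd d_bd bM qM (conc om).
rewrite conc0 o0 /=; have /andP[ip _] := gp; have := par_psi ip; lra.
Qed.

(** The factor [2 ^+ h] compensates [2^-1 ^+ i] for the parabolic [i], all below [h], so a double
    geometric series dominates the weights. *)
Let Gbound := expR (M * (phiB h + ln C + ln (dB h)) + MP) * 2 ^+ h.

(** Beyond this threshold the slope in [n] given by [pot_LetA_le] is below -1, and [expR (- 1)] is
    at most one half. *)
Lemma sum_loop_weight_large : M * (B + `|1 + gam|) + 1 < s ->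
  (\esum_(p in [set: nat * nat]) (loop_weight p)%:E <= (4 * Gbound)%:E)%E.
Proof.
move=> s0s; have [P1 P2] := ler_normlP _ _ P_bd.
have G0 : 0 <= Gbound by rewrite mulr_ge0 ?expR_ge0 ?exprn_ge0.
apply: le_trans (esum_geometric2 G0); apply: le_esum => p _; rewrite lee_fin.
rewrite /loop_weight; case: ifPn => [gp|_]; last first.
  by rewrite !mulr_ge0 // exprn_ge0 // invr_ge0.
have /andP[ip n0] := gp; have S := loop_point_SigB gp.
have Vle := pot_LetA_le phi_bd d_bd C_ge1 adm s bM qM S erefl (par_phi ip).
have e2 : expR (- 1) <= 2^-1 :> R.
  rewrite expRN lef_pV2 ?posrE ?expR_gt0 //; have := expR_ge1Dx (1 : R); lra.
apply: (@le_trans _ _ (expR (M * (phiB h + ln C + ln (dB h)) + MP) * expR (- 1) ^+ p.2)).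
  rewrite -expRM_natl -expRD ler_expR.
  have n1 : 0 <= p.2%:R :> R by [].
  have : p.2%:R * (M * (B + `|1 + gam|) - s) <= p.2%:R * (-1) by apply: ler_wpM2l => //; lra.
  rewrite -/V in Vle; lra.
rewrite /Gbound -!mulrA ler_wpM2l ?expR_ge0 //.
apply: (@le_trans _ _ (2^-1 ^+ p.2)); first by rewrite lerXn2r ?nnegrE ?expR_ge0 ?invr_ge0.
rewrite mulrA ler_peMl ?exprn_ge0 ?invr_ge0 //.
rewrite exprVn ler_pdivlMr ?exprn_gt0 // mul1r ler_eXn2l ?ltr1n //.
exact: ltnW.
Qed.

Definition loop_sum_bound : R :=
  expR (osc + MP + B + (M * (B + `|1 + gam|) + 1)) + 4 * Gbound.

Lemma sum_loop_weight :
  (\esum_(p in [set: nat * nat]) (loop_weight p)%:E <= loop_sum_bound%:E)%E.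
Proof.
have G0 : 0 <= 4 * Gbound by rewrite !mulr_ge0 ?expR_ge0 ?exprn_ge0.
have [/sum_loop_weight_small|/sum_loop_weight_large] := leP s (M * (B + `|1 + gam|) + 1).
  by move/le_trans; apply; rewrite lee_fin lerDl.
by move/le_trans; apply; rewrite lee_fin lerDr expR_ge0.
Qed.

Let am m : R := fine (expeR (psi_sup f phi b q m)).

Lemma psi_sup_fin m : (am m)%:E = expeR (psi_sup f phi b q m) /\
  am m <= expR (psi_bound M phiB dB m).
Proof.
have sup_ge : ((psi_bq f phi b q (fun=> m))%:E <= psi_sup f phi b q m)%E.
  by apply: ereal_sup_ubound; exists (fun=> m).
have sup_le : (psi_sup f phi b q m <= (psi_bound M phiB dB m)%:E)%E.
  apply: ge_ereal_sup => _ [u [_ [um]] <-]; rewrite lee_fin -um.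
  by have /ler_normlP[] := psi_bq_bound phi_bd d_bd bM qM u.
rewrite /am; case: (psi_sup _ _ _ _ _) sup_ge sup_le => [r| |] //=.
by rewrite !lee_fin => _ rB; rewrite ler_expR.
Qed.

Lemma psi_le_am u : expR (psi_bq f phi b q u) <= am (u 0%N).
Proof.
rewrite -lee_fin (psi_sup_fin _).1 -[leLHS]/(expeR (psi_bq f phi b q u)%:E) lee_expeR.
by apply: ereal_sup_ubound; exists u.
Qed.

(** The cost of exchanging the first symbol for [h] (the size of [psi_bq] there and the
    admissibility constant twice) and of moving to the reference point. *)
Let c1 := expR (psi_bound M phiB dB h + 2 * M * ln C + osc).

(** On [iH] the return time is 1, and the factor left beside that of [psi_bq] is exactly
    [expR (- s - P)]. *)
Let cc (o : option (nat * nat)) : R :=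
  if o is Some p then c1 * loop_weight p else expR (- s - P).

Let am_ge0 m : 0 <= am m.
Proof. by rewrite fine_ge0 // expeR_ge0. Qed.

Let cc_ge0 o : 0 <= cc o.
Proof. by case: o => [p|] /=; rewrite ?mulr_ge0 ?expR_ge0 ?loop_weight_ge0. Qed.

Lemma weight_le om : SigB f om ->
  expR (V om - P) <= am (fstletter (om 0%N)) * cc (restletter (om 0%N)).
Proof.
move=> S; have := psi_le_am (conc om); rewrite conc0.
case E : (om 0%N) => [i|m i n] /= ham.
  rewrite /V (pot_LetH phi b q s S E) -addrA expRD ler_wpM2r ?expR_ge0 //.
have [isl _] := S; have := isl 0%N; rewrite E => -[ip mi n0].
have gp : good_pair (i, n) by rewrite /good_pair ip.
(* The first letter is replaced by [h i^n A_i]; the new point is then compared with the reference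
   point of that letter. *)
pose om' : nat -> letter := fun k => if k is 0%N then LetA h i n else om k.
have S' : SigB f om' by exact: SigB_replace S E (h_neq ip).
have o0' : om' 0%N = LetA h (i, n).1 (i, n).2 by [].
have [] := ler_normlP _ _ (psi_bq_bound phi_bd d_bd bM qM (conc om')).
have [] := ler_normlP _ _ (V_loop_osc S' o0' gp).
have := pot_replace phi d_bd C_ge1 adm q s bM S E (h_neq ip) (erefl om').
rewrite conc0 /= -/V => h1 h2 h3 h4 h5.
apply: (@le_trans _ _ (expR (psi_bq f phi b q (conc om)) *
  (c1 * expR (V (loop_point (i, n)) - P)))).
  rewrite /c1 -!expRD ler_expR; move: h1 h2 h3 h4 h5.
  move: (psi_bq _ _ _ _ (conc om)) (psi_bq _ _ _ _ (conc om')) => x x'.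
  by move: (V om) (V om') (V (loop_point _)) => v v' v''; lra.
by rewrite /loop_weight gp ler_wpM2r ?mulr_ge0 ?expR_ge0.
Qed.

(** Built only from uniform constants and an upper bound [SL] of [- s], not from [b], [q], [s] or
    the Gibbs constant; hence the final estimate is uniform along the sequence. *)
Definition rest_bound SL : R := expR (SL + MP) + c1 * loop_sum_bound.

Lemma rest_bound_gt0 SL : 0 < rest_bound SL.
Proof.
apply: ltr_wpDr; last exact: expR_gt0.
by rewrite mulr_ge0 ?expR_ge0 // addr_ge0 ?expR_ge0 // !mulr_ge0 ?expR_ge0 ?exprn_ge0.
Qed.

Lemma sum_cc SL : - s <= SL ->
  (\esum_(o in [set: option (nat * nat)]) (cc o)%:E <= (rest_bound SL)%:E)%E.
Proof.
move=> sSL; apply: le_trans (esum_option (K := c1 * loop_sum_bound) cc_ge0 _) _.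
  rewrite /cc; under eq_esum do rewrite EFinM.
  apply: le_trans (esumZ_le (expR_ge0 _) _) _; first by move=> p _; rewrite lee_fin loop_weight_ge0.
  by rewrite EFinM lee_wpmul2l ?lee_fin ?expR_ge0 //; exact: sum_loop_weight.
rewrite lee_fin /rest_bound lerD2r ler_expR.
have [] := ler_normlP _ _ P_bd; lra.
Qed.

(** [tail_bound] for the product weights of [weight_le], whose sums factor by [esum_letter]. *)
Lemma letter_tail (F : set nat) (al be SL : R) : - s <= SL ->
  (forall A : set shift_space, measurable A -> nu (@wshift letter @^-1` A) = nu A) ->
  (\esum_(m in [set: nat]) expeR (psi_sup f phi b q m) <= al%:E)%E ->
  (\esum_(m in F) expeR (psi_sup f phi b q m) <= be%:E)%E ->
  0 < be * rest_bound SL < 1 ->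
  fine (nu [set om | F (fstletter (om 0%N))]) * - ln (be * rest_bound SL) <=
    ln (al * rest_bound SL + 1).
Proof.
move=> sSL nu_inv sal sbe db.
pose A e := am (fstletter e) * cc (restletter e).
have pos x (G : set nat) : (\esum_(m in G) expeR (psi_sup f phi b q m) <= x%:E)%E -> 0 <= x.
  by move=> hx; rewrite -lee_fin; apply: le_trans hx; apply: esum_ge0 => m _; exact: expeR_ge0.
have sum_am x (G : set nat) : (\esum_(m in G) expeR (psi_sup f phi b q m) <= x%:E)%E ->
    (\esum_(m in G) (am m)%:E <= x%:E)%E.
  by under eq_esum do rewrite -(psi_sup_fin _).1.
have sumA x (G : set nat) : (\esum_(m in G) expeR (psi_sup f phi b q m) <= x%:E)%E ->
    (\esum_(e in [set e | G (fstletter e)]) (A e)%:E <= (x * rest_bound SL)%:E)%E.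
  move=> hx; apply: esum_letter => //; [exact: pos hx|exact: sum_am|exact: sum_cc].
have A0 e : 0 <= A e by rewrite mulr_ge0.
apply: (@tail_bound R nu nu_inv A Q _ [set e | F (fstletter e)]) => //.
- move=> w; apply: (gibbs_upper nuS Q_ge1 gibbs) => // om S; exact: weight_le.
- rewrite (_ : [set: letter] = [set e | [set: nat] (fstletter e)]) //; exact: sumA.
- exact: sumA.
Qed.

End Weights.

(** * Tightness *)

Lemma finite_set_nat_bound (F : set nat) : finite_set F ->
  exists N, forall m, F m -> (m <= N)%N.
Proof.
move=> finF; exists (\max_(m <- finmap.enum_fset (fset_set F)) m) => m Fm.
by apply: leq_bigmax_seq => //; rewrite in_fset_set // inE.
Qed.

Lemma bounded_prefix (R : realType) (g : nat -> R) n :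
  exists B, forall i, (i < n)%N -> g i <= B.
Proof.
exists (\sum_(i < n) `|g i|) => i ltin; apply: le_trans (ler_norm _) _.
rewrite (bigD1 (Ordinal ltin)) //= lerDl; exact: sumr_ge0.
Qed.

(** Bounded [q] keeps [LB], and with it the larger pressure, bounded below; this controls the weight
    [expR (- s)] of the letters [iH]. *)
Lemma LB_ge (R : realType) (f : renyi_map R) (phi : R -> R) (q M : R) :
  `|q| <= M -> - (M * `|phi (xpar f 0)|) <= LB f phi q.
Proof.
move=> qM; apply: le_trans (bigmax_ge_id _ _ _ _); rewrite mulNr lerN2.
by apply: le_trans (ler_norm _) _; rewrite normrM ler_wpM2r.
Qed.

Theorem lemma3p6 (R : realType) (f : renyi_map R) (phi : R -> R)
  (b q : nat -> R) (nu : nat -> probability shift_space R)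
  (f_S : admissible_map f) (phi_R : regular f phi)
  (bq_bounded : exists M : R, forall n, `|b n| <= M /\ `|q n| <= M)
  (uniform_tail : forall eps : R, 0 < eps ->
     exists F : set nat, [/\ F `<=` hyperbolic f, finite_set (~` F) &
       forall n, (\esum_(m in F) expeR (psi_sup f phi (b n) (q n) m)
                  < eps%:E)%E])
  (ptilde_bounded : exists M : R, forall n,
     (`|ptilde f phi (b n) (q n) (fine (pressure f phi (b n) (q n)))|
      <= M%:E)%E)
  (pressure_gt_LB : forall n, ((LB f phi (q n))%:E < pressure f phi (b n) (q n))%E)
  (nu_gibbs : forall n, is_induced_gibbs f phi (b n) (q n) (nu n)) :
  tight_on_Lambda f (fun n => mu_of f (nu n)).
Proof.
have [C [gam [C1 _ adm]]] := f_S.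
have [_ phi_pos phi_acc [beta beta0 hold]] := phi_R.
have [phiB phiBP] := acceptable_bounded phi_acc.
have [dB dBP] := dfn1_bounded f.
have [D oscP] := holder_letter_osc beta0 hold.
have [M bqM] := bq_bounded; have [MP PM] := ptilde_bounded.
have phi_bd u : 0 <= phi (cpi f u) <= phiB (u 0%N).
  by rewrite phiBP (ereal_inf_gt0 phi_pos) //; exists u.
have [B1 B1P] := bounded_prefix phiB (npar f).
have [B2 B2P] := bounded_prefix (psi_bound M phiB dB) (npar f).
pose B := Num.max B1 B2.
have BphiP i : (i < npar f)%N -> phiB i <= B by move=> /B1P h; rewrite le_max h.
have BpsiP i : (i < npar f)%N -> psi_bound M phiB dB i <= B.
  by move=> /B2P h; rewrite le_max h orbT.
pose SL := M * `|phi (xpar f 0)|.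
have sSL n : - fine (pressure f phi (b n) (q n)) <= SL.
  have [Fin LBp _] := nu_gibbs n; have [_ qM] := bqM n.
  have := LB_ge f phi qM; move: Fin LBp; rewrite /in_Fin.
  by case: pressure => [r| |] //=; rewrite lte_fin => _ h1 h2; rewrite lerNl; apply/ltW/(le_lt_trans h2).
pose ka := rest_bound f M D C gam phiB dB MP B SL.
have tail n (F : set nat) (al be : R) :
    (\esum_(m in [set: nat]) expeR (psi_sup f phi (b n) (q n) m) <= al%:E)%E ->
    (\esum_(m in F) expeR (psi_sup f phi (b n) (q n) m) <= be%:E)%E ->
    0 < be * ka < 1 ->
    fine (nu n [set om | F (fstletter (om 0%N))]) * - ln (be * ka) <= ln (al * ka + 1).
  have [_ _ [nuS nu_inv [P PE [Q Q1 gibbs]]]] := nu_gibbs n.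
  have [bM qM] := bqM n.
  have P_bd : `|P| <= MP by have := PM n; rewrite /ptilde PE /= lee_fin.
  exact: (letter_tail phi_bd dBP C1 adm oscP bM qM nuS Q1 gibbs P_bd BphiP BpsiP).
have nuS n : nu n (SigB f) = 1%E by have [_ _ []] := nu_gibbs n.
have ka0 : 0 < ka by exact: rest_bound_gt0.
(* The uniform tail with [eps = 1] leaves finitely many symbols, and on each of these [psi_bq] is
   bounded uniformly in [n]. *)
have [al alP] : exists al, forall n,
    (\esum_(m in [set: nat]) expeR (psi_sup f phi (b n) (q n) m) <= al%:E)%E.
  have [F [_ finF tF]] := uniform_tail 1 ltr01.
  exists (1 + \sum_(m <- finmap.enum_fset (fset_set (~` F))) expR (psi_bound M phiB dB m)) => n.
  rewrite (@esumID _ _ F); last by move=> m _; exact: expeR_ge0.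
  rewrite !setTI EFinD; apply: leeD; first exact: ltW.
  rewrite esum_fset //; last by move=> m _; exact: expeR_ge0.
  rewrite fsbig_finite // -sumEFin; apply: lee_sum => m _.
  have [bM qM] := bqM n; have [<-] := psi_sup_fin phi_bd dBP bM qM m.
  by rewrite lee_fin.
have al0 : 0 <= al.
  by rewrite -lee_fin; apply: le_trans (alP 0%N); apply: esum_ge0 => m _; exact: expeR_ge0.
have l0 : 0 <= ln (al * ka + 1) by rewrite ln_ge0 // lerDr mulr_ge0 // ltW.
have letters e : 0 < e -> exists N, (npar f <= N)%N /\ forall n,
    (nu n (SigB f `&` [set om | (N < fstletter (om 0%N))%N]) <= e%:E)%E.
  (* With this [d], [tail] reads mass times [(l + 1) / e] at most [l], so the mass is at most [e].
     The 1 added to [l] keeps [d] below 1. *)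
  move=> e0; pose l := ln (al * ka + 1); pose d := expR (- ((l + 1) / e)).
  have d0 : 0 < d by exact: expR_gt0.
  have d1 : d < 1.
    by rewrite /d -expR0 ltr_expR oppr_lt0 divr_gt0 // ltr_wpDl.
  have [F [_ finF tF]] := uniform_tail (d / ka) (divr_gt0 d0 ka0).
  have [N NP] := finite_set_nat_bound finF.
  (* [npar f] is the threshold required by [tower_base]; above [N] every symbol belongs to [F]. *)
  exists (maxn (npar f) N); split; first exact: leq_maxl.
  move=> n.
  have mF : measurable [set om : shift_space | F (fstletter (om 0%N))].
    exact: (@measurable_letter0 (fun e => F (fstletter e))).
  have mN : measurable [set om : shift_space | (maxn (npar f) N < fstletter (om 0%N))%N].
    exact: (@measurable_letter0 (fun e => (maxn (npar f) N < fstletter e)%N)).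
  rewrite nu_SigBI //; apply: (@le_trans _ _ (nu n [set om | F (fstletter (om 0%N))])).
    apply: le_measure; rewrite ?inE // => om /=.
    rewrite gtn_max => /andP[_ No]; apply: contrapT => nF.
    by have := NP _ nF; rewrite leqNgt No.
  rewrite -(fineK (fin_num_measure (nu n) _ mF)) lee_fin.
  have := tail n F al (d / ka) (alP n) (ltW (tF n)).
  rewrite divfK ?gt_eqF // d0 d1 => /(_ isT).
  rewrite /d expRK opprK -/l mulrA ler_pdivrMr // => h.
  have : fine (nu n [set om | F (fstletter (om 0%N))]) * (l + 1) <= e * (l + 1).
    by apply: le_trans h _; rewrite mulrDr mulr1 mulrC lerDl ltW.
  by rewrite ler_pM2r // ltr_wpDl.
move=> e e0.
(* The allowances for the positions [k] add up to [e / 2], which leaves room for the strict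
   inequality in tightness. *)
have e2 k : 0 < e / 2 / (2 ^ k.+1)%:R by rewrite !divr_gt0 // ltr0n expn_gt0.
have [N NP] := choice (fun k => letters _ (e2 k)).
exists (cpi f @` [set u | forall k, (u k <= N k)%N]); split.
- exact: compact_cpi_bounded.
- by move=> _ [u _ <-]; exists u.
move=> n; have [_ _ [_ nu_inv _]] := nu_gibbs n.
apply: le_lt_trans (mu_of_le (nuS n) nu_inv (fun k => (NP k).1)) _.
apply: (@le_lt_trans _ _ (e / 2)%:E); last by rewrite lte_fin; lra.
apply: le_trans (epsilon_trick0 xpredT (_ : 0 <= e / 2)); last by lra.
by apply: lee_nneseries => // k _; exact: (NP k).2.
Qed.
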